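(* Let $A$ be a finite-dimensional basic algebra over a field. Let $(M,P)$ and $(M',P')$ be $\tau$-rigid pairs over $A$ and let $(N,Q)$ be their maximal common direct summand. Then $\overline{\mathcal{C}}_{(M,P)}\cap\overline{\mathcal{C}}_{(M',P')}=\overline{\mathcal{C}}_{(N,Q)}$.
   Context: $A$ is a finite-dimensional basic algebra over an arbitrary field with $n$ isomorphism classes of simple modules; $\mathrm{mod}\,A$ is the category of finitely generated right $A$-modules, $\tau$ the Auslander–Reiten translation, $P(1),\dots,P(n)$ the indecomposable projective modules. A $\tau$-rigid pair $(M,P)$ consists of $M\in\mathrm{mod}\,A$ with $\mathrm{Hom}_A(M,\tau M)=0$ and a finitely generated projective $P$ with $\mathrm{Hom}_A(P,M)=0$. If $P_{-1}\to P_0\to M\to0$ is a minimal projective presentation of $M$ with $P_0=\bigoplus_{i=1}^nP(i)^{a_i}$ and $P_{-1}=\bigoplus_{i=1}^nP(i)^{b_i}$, the $g$-vector of $M$ is $g^M=(a_1-b_1,\dots,a_n-b_n)$. For a $\tau$-rigid pair $(M,P)$ with indecomposable direct summands $M_1,\dots,M_k$ of $M$ and $P_{k+1},\dots,P_t$ of $P$, put $$\overline{\mathcal{C}}_{(M,P)}=\mathrm{cone}\{g^{M_1},\dots,g^{M_k},-g^{P_{k+1}},\dots,-g^{P_t}\}\subseteq\mathbb{R}^n,$$ where $\mathrm{cone}$ denotes the set of non-negative linear combinations (and $\overline{\mathcal{C}}_{(0,0)}=\{0\}$). The direct summands of $(M,P)$ are the pairs $(N,Q)$ with $N$ a direct summand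 of $M$ and $Q$ a direct summand of $P$. *)

(* Defs.v *)
From HB Require Import structures.
From mathcomp Require Import all_boot all_order all_algebra all_field.
From mathcomp Require Import classical_sets reals.

Set Implicit Arguments.
Unset Strict Implicit.
Unset Printing Implicit Defensive.

Import GRing.Theory.

Local Open Scope ring_scope.

Section Modules.
Variables (K : fieldType) (A : falgType K).

(* As A is finite dimensional over K, the finitely generated A-modules are
   exactly those of finite dimension over K.  [ract M a] is x |-> x a. *)
Record rmodule := RModule {
  rcarrier :> vectType K;
  ract : {linear A -> 'End(rcarrier)};
  ract1 : ract 1 = \1%VF;
  ractM : forall a b, ract (a * b) = (ract b \o ract a)%VF }.

Record lmodule := LModule {
  lcarrier :> vectType K;
  lact : {linear A -> 'End(lcarrier)};
  lact1 : lact 1 = \1%VF;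
  lactM : forall a b, lact (a * b) = (lact a \o lact b)%VF }.

Section Hom.
Variables M N : rmodule.

Definition hom_defect_fun (f : 'Hom(M, N)) (a : A) : 'Hom(M, N) :=
  ((f \o ract M a) - (ract N a \o f))%VF.
Fact hom_defect_fun_linear f : linear (hom_defect_fun f).
Proof.
move=> k a b; apply/lfunP=> x; rewrite /hom_defect_fun !linearP.
rewrite !(add_lfunE, scale_lfunE, opp_lfunE, comp_lfunE) linearP.
by rewrite scalerBr opprD addrACA.
Qed.
HB.instance Definition _ f :=
  GRing.isLinear.Build _ _ _ _ _ (hom_defect_fun_linear f).
Definition hom_defect (f : 'Hom(M, N)) : 'Hom(A, 'Hom(M, N)) :=
  linfun (hom_defect_fun f).
Fact hom_defect_linear : linear hom_defect.
Proof.
move=> k f g; apply/lfunP=> a; rewrite add_lfunE scale_lfunE !lfunE /=.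
apply/lfunP=> x; rewrite /hom_defect_fun.
rewrite !(add_lfunE, scale_lfunE, opp_lfunE, comp_lfunE) linearP.
by rewrite scalerBr opprD addrACA.
Qed.
HB.instance Definition _ := GRing.isLinear.Build _ _ _ _ _ hom_defect_linear.

(* Hom_A(M, N), as a subspace of Hom_K(M, N); see [homvP] *)
Definition homv : {vspace 'Hom(M, N)} := lker (linfun hom_defect).

Lemma homvP (f : 'Hom(M, N)) :
  reflect (forall x a, f (ract M a x) = ract N a (f x)) (f \in homv).
Proof.
rewrite memv_ker lfunE /=; apply: (iffP eqP) => [f0 x a | fA].
  have /lfunP/(_ a) := f0; rewrite !lfunE /= => /lfunP/(_ x).
  rewrite /hom_defect_fun !(add_lfunE, opp_lfunE, comp_lfunE) zero_lfunE.
  by move/eqP; rewrite subr_eq0 => /eqP.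
apply/lfunP=> a; rewrite !lfunE /=; apply/lfunP=> x.
rewrite /hom_defect_fun !(add_lfunE, opp_lfunE, comp_lfunE) zero_lfunE fA.
by rewrite subrr.
Qed.

End Hom.

Definition lhom (L L' : lmodule) (f : 'Hom(L, L')) : Prop :=
  forall a x, f (lact L a x) = lact L' a (f x).

Definition iso (M N : rmodule) : Prop :=
  exists2 f : 'Hom(M, N), f \in homv M N & bijective f.

Definition zeromod (M : rmodule) : Prop := forall x : M, x = 0.

Definition submod (M : rmodule) (U : {vspace M}) : Prop :=
  forall a, (ract M a @: U <= U)%VS.

Definition simple_module (S : rmodule) : Prop :=
  ~ zeromod S /\
  forall U : {vspace S}, submod U -> U = 0%VS \/ U = fullv.

Fact regular_act1 : amulr (1 : A) = \1%VF.
Proof. by apply/lfunP=> x; rewrite id_lfunE lfunE /= mulr1. Qed.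
Fact regular_actM (a b : A) : amulr (a * b) = (amulr b \o amulr a)%VF.
Proof. by apply/lfunP=> x; rewrite comp_lfunE !lfunE /= mulrA. Qed.

(* the right module A_A *)
Definition regular : rmodule := RModule regular_act1 regular_actM.

Definition rzero_act (a : A) : 'End('rV[K]_0) := 0.
Fact rzero_act_linear : linear rzero_act.
Proof. by move=> k a b; rewrite /rzero_act scaler0 addr0. Qed.
HB.instance Definition _ :=
  GRing.isLinear.Build _ _ _ _ _ rzero_act_linear.
Fact rzero_act1 : rzero_act 1 = \1%VF.
Proof. by apply/lfunP=> x; rewrite [LHS]thinmx0 [RHS]thinmx0. Qed.
Fact rzero_actM a b : rzero_act (a * b) = (rzero_act b \o rzero_act a)%VF.
Proof. by apply/lfunP=> x; rewrite [LHS]thinmx0 [RHS]thinmx0. Qed.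
Definition rzero : rmodule := RModule rzero_act1 rzero_actM.

Section DirectSum.
Variables M N : rmodule.

Definition dsum_fun (a : A) (x : M * N) : M * N :=
  (ract M a x.1, ract N a x.2).
Fact dsum_fun_linear a : linear (dsum_fun a).
Proof. by move=> k x y; rewrite /dsum_fun /= !linearP. Qed.
HB.instance Definition _ a :=
  GRing.isLinear.Build _ _ _ _ _ (dsum_fun_linear a).
Definition dsum_act (a : A) : 'End((M * N)%type) := linfun (dsum_fun a).
Fact dsum_act_linear : linear dsum_act.
Proof.
move=> k a b; apply/lfunP=> x; rewrite add_lfunE scale_lfunE !lfunE /=.
by rewrite /dsum_fun !linearP !add_lfunE !scale_lfunE.
Qed.
HB.instance Definition _ := GRing.isLinear.Build _ _ _ _ _ dsum_act_linear.
Fact dsum_act1 : dsum_act 1 = \1%VF.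
Proof.
by apply/lfunP=> -[x y]; rewrite lfunE /= /dsum_fun !ract1 !id_lfunE.
Qed.
Fact dsum_actM a b : dsum_act (a * b) = (dsum_act b \o dsum_act a)%VF.
Proof.
apply/lfunP=> -[x y]; rewrite comp_lfunE !lfunE /= /dsum_fun.
by rewrite !ractM !comp_lfunE.
Qed.
Definition dsum : rmodule := RModule dsum_act1 dsum_actM.

End DirectSum.

Definition dsums (s : seq rmodule) : rmodule := foldr dsum rzero s.

Definition summand (N M : rmodule) : Prop :=
  exists N' : rmodule, iso M (dsum N N').

Definition indecomposable (M : rmodule) : Prop :=
  ~ zeromod M /\
  forall X Y : rmodule, iso M (dsum X Y) -> zeromod X \/ zeromod Y.

Definition projective (P : rmodule) : Prop :=
  forall (X Y : rmodule) (g : 'Hom(X, Y)) (f : 'Hom(P, Y)),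
    g \in homv X Y -> limg g = fullv -> f \in homv P Y ->
    exists2 h : 'Hom(P, X), h \in homv P X & (g \o h)%VF = f.

(* no repeated summand in a decomposition of A_A into indecomposables *)
Definition basic : Prop :=
  exists (m : nat) (X : 'I_m -> rmodule),
    [/\ forall i, indecomposable (X i),
        forall i j, iso (X i) (X j) -> i = j
      & iso regular (dsums [seq X i | i <- enum 'I_m])].

(* X lists the isomorphism classes of modules in C, without repetition *)
Definition iso_representatives n (C : rmodule -> Prop) (X : 'I_n -> rmodule) :
    Prop :=
  [/\ forall i, C (X i),
      forall i j, iso (X i) (X j) -> i = j
    & forall Y, C Y -> exists i, iso Y (X i)].

Definition superfluous (M : rmodule) (U : {vspace M}) : Prop :=
  forall V : {vspace M}, submod V -> (U + V)%VS = fullv -> V = fullv.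

(* P1 -d-> P0 -e-> M -> 0 is exact, and P0 ->> M and P1 ->> ker e are
   projective covers *)
Definition min_proj_pres (M P1 P0 : rmodule)
    (d : 'Hom(P1, P0)) (e : 'Hom(P0, M)) : Prop :=
  [/\ projective P1 /\ projective P0,
      d \in homv P1 P0 /\ e \in homv P0 M,
      limg e = fullv /\ limg d = lker e
    & superfluous (lker e) /\ superfluous (lker d)].

Section Star.
Variable M : rmodule.
Notation carrier := (subvs_of (homv M regular)).

Definition star_fun (a : A) (f : carrier) : carrier :=
  vsproj (homv M regular) (amull a \o vsval f)%VF.
Fact star_fun_val a f : vsval (star_fun a f) = (amull a \o vsval f)%VF.
Proof.
rewrite vsprojK //; apply/homvP=> x b; rewrite !comp_lfunE.
by have /homvP-> := valP f; rewrite !lfunE /= mulrA.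
Qed.
Fact star_fun_linear a : linear (star_fun a).
Proof.
move=> k f g; apply: val_inj; rewrite linearP /= !star_fun_val linearP /=.
apply/lfunP=> x; rewrite !(add_lfunE, scale_lfunE, comp_lfunE) !lfunE /=.
by rewrite mulrDr scalerAr.
Qed.
HB.instance Definition _ a :=
  GRing.isLinear.Build _ _ _ _ _ (star_fun_linear a).
Definition star_act (a : A) : 'End(carrier) := linfun (star_fun a).
Fact star_act_linear : linear star_act.
Proof.
move=> k a b; apply/lfunP=> f; rewrite add_lfunE scale_lfunE !lfunE /=.
apply: val_inj; rewrite linearP /= !star_fun_val.
apply/lfunP=> x; rewrite !(add_lfunE, scale_lfunE, comp_lfunE) !lfunE /=.
by rewrite mulrDl scalerAl.
Qed.
HB.instance Definition _ := GRing.isLinear.Build _ _ _ _ _ star_act_linear.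
Fact star_act1 : star_act 1 = \1%VF.
Proof.
apply/lfunP=> f; rewrite id_lfunE lfunE /=; apply: val_inj.
by rewrite /= star_fun_val amull1 comp_lfun1l.
Qed.
Fact star_actM a b : star_act (a * b) = (star_act a \o star_act b)%VF.
Proof.
apply/lfunP=> f; rewrite comp_lfunE !lfunE /=; apply: val_inj.
rewrite /= !star_fun_val; apply/lfunP=> x.
by rewrite !comp_lfunE !lfunE /= mulrA.
Qed.

(* the left module Hom_A(M, A), with (a f)(x) = a f(x) *)
Definition star : lmodule := LModule star_act1 star_actM.

End Star.

Section StarMap.
Variables (M N : rmodule) (f : 'Hom(M, N)).

Definition star_map_fun (phi : star N) : star M :=
  vsproj (homv M regular) (vsval phi \o f)%VF.
Fact star_map_fun_linear : linear star_map_fun.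
Proof.
move=> k phi psi; rewrite /star_map_fun -linearP; congr vsproj.
by apply/lfunP=> x; rewrite !(add_lfunE, scale_lfunE, comp_lfunE).
Qed.
HB.instance Definition _ :=
  GRing.isLinear.Build _ _ _ _ _ star_map_fun_linear.

(* Hom_A(f, A) : Hom_A(N, A) -> Hom_A(M, A); see [star_mapE].  For f not
   A-linear the value is meaningless. *)
Definition star_map : 'Hom(star N, star M) := linfun star_map_fun.

Lemma star_mapE (phi : star N) :
  f \in homv M N -> vsval (star_map phi) = (vsval phi \o f)%VF.
Proof.
move=> /homvP fA; rewrite lfunE /= vsprojK //; apply/(@homvP M regular)=> x a.
rewrite !comp_lfunE fA.
by have /homvP-> := subvsP (phi : subvs_of (homv N regular)).
Qed.

End StarMap.

Section Dual.
Variable L : lmodule.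

Definition dual_fun (a : A) (xi : 'Hom(L, K^o)) : 'Hom(L, K^o) :=
  (xi \o lact L a)%VF.
Fact dual_fun_linear a : linear (dual_fun a).
Proof.
by move=> k f g; apply/lfunP=> x; rewrite !(add_lfunE, scale_lfunE, comp_lfunE).
Qed.
HB.instance Definition _ a :=
  GRing.isLinear.Build _ _ _ _ _ (dual_fun_linear a).
Definition dual_act (a : A) : 'End('Hom(L, K^o)) := linfun (dual_fun a).
Fact dual_act_linear : linear dual_act.
Proof.
move=> k a b; apply/lfunP=> f; rewrite add_lfunE scale_lfunE !lfunE /=.
apply/lfunP=> x; rewrite /dual_fun linearP.
by rewrite !(add_lfunE, scale_lfunE, comp_lfunE) linearP.
Qed.
HB.instance Definition _ := GRing.isLinear.Build _ _ _ _ _ dual_act_linear.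
Fact dual_act1 : dual_act 1 = \1%VF.
Proof.
apply/lfunP=> f; rewrite id_lfunE lfunE /= /dual_fun.
by rewrite lact1 comp_lfun1r.
Qed.
Fact dual_actM a b : dual_act (a * b) = (dual_act b \o dual_act a)%VF.
Proof.
apply/lfunP=> f; rewrite comp_lfunE !lfunE /= /dual_fun.
by rewrite lactM comp_lfunA.
Qed.

(* the right module D L = Hom_K(L, K), with (xi a)(x) = xi(a x) *)
Definition kdual : rmodule := RModule dual_act1 dual_actM.

End Dual.

(* L is isomorphic to Tr M = Coker (Hom_A(P0, A) -> Hom_A(P1, A)), for a
   minimal projective presentation P1 -> P0 -> M -> 0 *)
Definition is_transpose (M : rmodule) (L : lmodule) : Prop :=
  exists (P1 P0 : rmodule) (d : 'Hom(P1, P0)) (e : 'Hom(P0, M)),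
    min_proj_pres d e /\
    exists pi : 'Hom(star P1, L),
      [/\ lhom pi, limg pi = fullv & lker pi = limg (star_map d)].

(* T is isomorphic to tau M = D Tr M *)
Definition is_tau (M T : rmodule) : Prop :=
  exists2 L : lmodule, is_transpose M L & iso T (kdual L).

Definition rpair : Type := rmodule * rmodule.

Definition tau_rigid_pair (T : rpair) : Prop :=
  [/\ exists2 tM : rmodule, is_tau T.1 tM & homv T.1 tM = 0%VS,
      projective T.2
    & homv T.2 T.1 = 0%VS].

Definition pair_iso (S T : rpair) : Prop := iso S.1 T.1 /\ iso S.2 T.2.

Definition pair_summand (S T : rpair) : Prop :=
  summand S.1 T.1 /\ summand S.2 T.2.

Definition max_common_summand (T T' S : rpair) : Prop :=
  [/\ pair_summand S T, pair_summand S T'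
    & forall S', pair_summand S' T -> pair_summand S' T' ->
        pair_summand S S' -> pair_iso S S'].

Section Cones.
Variables (n : nat) (P : 'I_n -> rmodule).

Definition proj_sum (a : 'I_n -> nat) : rmodule :=
  dsums (flatten [seq nseq (a i) (P i) | i <- enum 'I_n]).

Definition is_gvector (M : rmodule) (g : 'rV[int]_n) : Prop :=
  exists (a b : 'I_n -> nat)
         (d : 'Hom(proj_sum b, proj_sum a)) (e : 'Hom(proj_sum a, M)),
    min_proj_pres d e /\ g = \row_i ((a i)%:Z - (b i)%:Z).

Variable R : realType.

Definition cone (G : set 'rV[R]_n) : set 'rV[R]_n :=
  [set x | exists (k : nat) (v : 'I_k -> 'rV[R]_n) (c : 'I_k -> R),
     [/\ forall i, G (v i), forall i, 0 <= c i
       & x = \sum_(i < k) c i *: v i]]%classic.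

Definition gcone_generators (T : rpair) : set 'rV[R]_n :=
  ([set v | exists X g, [/\ indecomposable X, summand X T.1, is_gvector X g
                          & v = map_mx intr g]] `|`
   [set v | exists X g, [/\ indecomposable X, summand X T.2, is_gvector X g
                          & v = - map_mx intr g]])%classic.

Definition gcone (T : rpair) : set 'rV[R]_n := cone (gcone_generators T).

End Cones.

End Modules.

Arguments gcone {K A n} P R T.

(* Main.v *)
Require Import Defs.
From HB Require Import structures.
From mathcomp Require Import all_boot all_order all_algebra all_field.
From mathcomp Require Import boolp classical_sets reals.

(** A vector theta of R^n is treated as a functional on modules,
      theta(Y) = sum_l theta_l dim Hom(P_l, Y),
    and theta is recovered from it, because the tops of the indecomposable
    projectives separate the coordinates.  If P1 -> P0 -> X -> 0 is a minimal
    projective presentation, then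
      g^X(Y) = dim Hom(P0, Y) - dim Hom(P1, Y) <= dim Hom(X, Y),
    and the defect is the dimension of the cokernel of Hom(P0, Y) -> Hom(P1, Y),
    which is dual to Hom(Y, tau X) (Auslander and Reiten).  So for summands X of
    the tau-rigid module M the defect vanishes when Y is in Fac M; likewise
    Hom(Q, Y) = 0 for such Y.

    Suppose that theta is a combination with positive coefficients of rays of
    (M, Q), and let X_1, ..., X_r be the modules among them that are not taken
    from Q.  Then Fac of the X_i consists of the modules Y such that theta is
    positive on all nonzero quotients of Y.  In one direction theta(Y) is a sum
    of positive multiples of dim Hom(X_i, Y) ([gval_trace_pos]).  In the other,
    the quotient Z of Y by the trace of the X_i satisfies Hom(X_i, Z) = 0, since
    Ext^1(X_i, Fac M) = 0, so theta(Z) <= 0 and Z = 0 ([trace_full]).  Thus this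
    torsion class depends on theta only, and works for real coefficients without
    any passage to integral points.

    Now let theta lie in both cones.  The isomorphism classes that occur in both
    expressions of theta can be cancelled against each other, with the smaller
    of their two coefficients ([common_cone]), until the two expressions have
    disjoint supports.  The modules in the two supports then generate the same
    torsion class, hence each other.  But two families of indecomposables
    without a common member that generate each other are empty, by Nakayama's
    lemma ([mutual_generation]).  What is left are two combinations of the
    -g^P for disjoint sets of indecomposable projectives P; they are zero, as is
    seen on the tops of the P ([disjoint_support_zero]).  So theta is a
    nonnegative combination of rays of common indecomposable summands, and these
    are summands of (N, U) by maximality and the Krull-Schmidt property
    ([max_common_indecomp]).  The other inclusion holds since the rays of a
    summand of a pair are rays of the pair. *)

Set Implicit Arguments.
Unset Strict Implicit.
Unset Printing Implicit Defensive.
Import Order.TTheory GRing.Theory Num.Theory.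
Local Open Scope ring_scope.

(** * Submodules, quotients and factorizations *)

(** A version of [lfunE] for maps whose linearity is a hypothesis, so that
    maps built inside a proof need not be declared linear beforehand. *)
Lemma linfun_linearE (K : fieldType) (V W : vectType K) (f : V -> W) :
  linear f -> forall x, linfun f x = f x.
Proof.
move=> lf; pose m := GRing.isLinear.Build _ _ _ _ f lf.
pose F : {linear V -> W} := HB.pack f m.
exact: (lfunE F).
Qed.

Lemma limg_surj (K : fieldType) (V W : vectType K) (f : 'Hom(V, W)) :
  limg f = fullv -> forall y, exists x, y = f x.
Proof.
by move=> ff y; have := memvf y; rewrite -ff => /memv_imgP[x _ ->]; exists x.
Qed.

Section Basics.
Variables (K : fieldType) (A : falgType K).
Implicit Types M N L X Y Z P : rmodule A.

Lemma homv_id M : \1%VF \in homv M M.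
Proof. by apply/homvP=> x a; rewrite !id_lfunE. Qed.

Lemma homv_comp M N L (f : 'Hom(M, N)) (g : 'Hom(N, L)) :
  f \in homv M N -> g \in homv N L -> (g \o f)%VF \in homv M L.
Proof.
by move=> /homvP fA /homvP gA; apply/homvP=> x a; rewrite !comp_lfunE fA gA.
Qed.

Lemma homv_inv M N (f : 'Hom(M, N)) :
  f \in homv M N -> lker f == 0%VS -> limg f = fullv ->
  (f^-1)%VF \in homv N M.
Proof.
move=> /homvP fA f0 ff; apply/homvP=> x a.
have [y ->] : exists y, x = f y.
  by have := memvf x; rewrite -ff => /memv_imgP[y _ ->]; exists y.
by rewrite -fA !lker0_lfunK.
Qed.

Lemma submodP M (U : {vspace M}) :
  submod U <-> forall a x, x \in U -> ract M a x \in U.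
Proof.
split=> [sU a x xU|sU a]; first by apply: (subvP (sU a)); apply: memv_img.
by apply/subvP=> _ /memv_imgP[x xU ->]; apply: sU.
Qed.

Lemma submod0 M : submod (0%VS : {vspace M}).
Proof. by apply/submodP=> a x; rewrite !memv0 => /eqP->; rewrite linear0. Qed.

Lemma submod_ker M N (f : 'Hom(M, N)) : f \in homv M N -> submod (lker f).
Proof.
move=> /homvP fA; apply/submodP=> a x.
by rewrite !memv_ker fA => /eqP->; rewrite linear0.
Qed.

Lemma submod_img M N (f : 'Hom(M, N)) : f \in homv M N -> submod (limg f).
Proof.
move=> /homvP fA; apply/submodP=> a _ /memv_imgP[x _ ->].
by rewrite -fA memv_img ?memvf.
Qed.

Lemma submod_add M (U V : {vspace M}) : submod U -> submod V -> submod (U + V).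
Proof.
move=> /submodP sU /submodP sV; apply/submodP=> a _ /memv_addP[u uU [v vV ->]].
by rewrite linearD memv_add ?sU ?sV.
Qed.

Lemma submod_sum M (I : finType) (B : pred I) (U : I -> {vspace M}) :
  (forall i, B i -> submod (U i)) -> submod (\sum_(i | B i) U i)%VS.
Proof.
move=> sU; elim/big_ind: _ => //; first exact: submod0.
by move=> ? ?; apply: submod_add.
Qed.

Section SubQuot.
Variables (M : rmodule A) (U : {vspace M}).

Definition sub_fun (a : A) (x : subvs_of U) : subvs_of U :=
  vsproj U (ract M a (vsval x)).
Fact sub_fun_linear a : linear (sub_fun a).
Proof. by move=> k x y; rewrite /sub_fun !linearP. Qed.
HB.instance Definition _ a :=
  GRing.isLinear.Build _ _ _ _ _ (sub_fun_linear a).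
Definition sub_act (a : A) : 'End(subvs_of U) := linfun (sub_fun a).
Fact sub_act_linear : linear sub_act.
Proof.
move=> k a b; apply/lfunP=> x; rewrite add_lfunE scale_lfunE !lfunE /=.
by rewrite /sub_fun linearP add_lfunE scale_lfunE linearP.
Qed.
HB.instance Definition _ := GRing.isLinear.Build _ _ _ _ _ sub_act_linear.

Hypothesis sU : submod U.
Fact sub_act1 : sub_act 1 = \1%VF.
Proof.
by apply/lfunP=> x; rewrite id_lfunE lfunE /= /sub_fun ract1 id_lfunE vsvalK.
Qed.
Fact sub_actM a b : sub_act (a * b) = (sub_act b \o sub_act a)%VF.
Proof.
apply/lfunP=> x; rewrite comp_lfunE !lfunE /= /sub_fun ractM comp_lfunE.
rewrite [vsval (vsproj U _)]vsprojK //.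
by apply: (submodP U).1 => //; apply: subvsP.
Qed.
Definition sub_rmodule : rmodule A := RModule sub_act1 sub_actM.

(** The quotient of [M] by [U] is realised on the complement [U^C], with the
    action of [M] followed by the projection along [U]. *)
Definition quo_fun (a : A) (x : subvs_of U^C) : subvs_of U^C :=
  vsproj U^C (daddv_pi U^C U (ract M a (vsval x))).
Fact quo_fun_linear a : linear (quo_fun a).
Proof. by move=> k x y; rewrite /quo_fun !linearP. Qed.
HB.instance Definition _ a :=
  GRing.isLinear.Build _ _ _ _ _ (quo_fun_linear a).
Definition quo_act (a : A) : 'End(subvs_of U^C) := linfun (quo_fun a).
Fact quo_act_linear : linear quo_act.
Proof.
move=> k a b; apply/lfunP=> x; rewrite add_lfunE scale_lfunE !lfunE /=.
by rewrite /quo_fun linearP add_lfunE scale_lfunE !linearP.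
Qed.
HB.instance Definition _ := GRing.isLinear.Build _ _ _ _ _ quo_act_linear.

Definition quo_map_fun (x : M) : subvs_of U^C := vsproj U^C (daddv_pi U^C U x).
Fact quo_map_linear : linear quo_map_fun.
Proof. by move=> k x y; rewrite /quo_map_fun !linearP. Qed.
HB.instance Definition _ := GRing.isLinear.Build _ _ _ _ _ quo_map_linear.

Fact capUCU : (U^C :&: U = 0)%VS. Proof. by rewrite capvC capv_compl. Qed.

Fact quo_map_ker x : (quo_map_fun x == 0) = (x \in U).
Proof.
have xE : x = daddv_pi U^C U x + daddv_pi U U^C x.
  by rewrite daddv_pi_add ?capUCU // addvC addv_complf memvf.
rewrite -(inj_eq val_inj) /= vsprojK ?memv_pi //.
apply/eqP/idP => [x0 | xU]; first by rewrite xE x0 add0r memv_pi.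
have : daddv_pi U^C U x \in (U^C :&: U)%VS.
  rewrite memv_cap memv_pi /=.
  have -> : daddv_pi U^C U x = x - daddv_pi U U^C x by rewrite {2}xE addrK.
  by rewrite memvB // memv_pi.
by rewrite capUCU memv0 => /eqP.
Qed.

Fact quo_map_act a x : quo_map_fun (ract M a x) = quo_act a (quo_map_fun x).
Proof.
rewrite [RHS]lfunE.
change (quo_map_fun (ract M a x) =
        quo_map_fun (ract M a (vsval (quo_map_fun x)))).
apply/eqP; rewrite -subr_eq0.
rewrite -linearB quo_map_ker -linearB; apply: (submodP U).1 => //.
rewrite -quo_map_ker linearB /= subr_eq0 /quo_map_fun.
by rewrite [daddv_pi _ _ (vsval _)]daddv_pi_id ?capUCU ?vsvalK // subvsP.
Qed.

Fact quo_map_sur z : exists x, quo_map_fun x = z.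
Proof.
exists (vsval z); rewrite /quo_map_fun daddv_pi_id ?capUCU ?vsvalK //.
exact: subvsP.
Qed.

Fact quo_act1 : quo_act 1 = \1%VF.
Proof.
apply/lfunP=> x; rewrite id_lfunE; have [y <-] := quo_map_sur x.
by rewrite -quo_map_act ract1 id_lfunE.
Qed.
Fact quo_actM a b : quo_act (a * b) = (quo_act b \o quo_act a)%VF.
Proof.
apply/lfunP=> x; rewrite comp_lfunE; have [y <-] := quo_map_sur x.
by rewrite -!quo_map_act ractM comp_lfunE.
Qed.
Definition quo_rmodule : rmodule A := RModule quo_act1 quo_actM.

Lemma exists_submodule : exists (Z : rmodule A) (j : 'Hom(Z, M)),
  [/\ j \in homv Z M, lker j == 0%VS & limg j = U].
Proof.
have vE x : linfun (@vsval _ _ U) x = vsval x by rewrite lfunE.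
exists sub_rmodule, (linfun (@vsval _ _ U) : 'Hom(subvs_of U, M)); split.
- apply/homvP=> x a; rewrite !vE [ract sub_rmodule a x]lfunE /=.
  rewrite /sub_fun [vsval (vsproj _ _)]vsprojK //.
  by apply: (submodP U).1 => //; apply: subvsP.
- by apply/lker0P=> x y; rewrite !vE => /val_inj.
apply/vspaceP=> x; apply/memv_imgP/idP => [[y _ ->]|xU].
  by rewrite vE; apply: subvsP.
by exists (vsproj U x); rewrite ?memvf // vE vsprojK.
Qed.

Lemma exists_quotient : exists (Z : rmodule A) (q : 'Hom(M, Z)),
  [/\ q \in homv M Z, limg q = fullv & lker q = U].
Proof.
have qE x : linfun quo_map_fun x = quo_map_fun x by rewrite lfunE.
exists quo_rmodule, (linfun quo_map_fun : 'Hom(M, subvs_of U^C)); split.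
- by apply/homvP=> x a; rewrite !qE; apply: quo_map_act.
- apply/vspaceP=> z; rewrite memvf; have [x <-] := quo_map_sur z.
  by apply/memv_imgP; exists x; rewrite ?memvf // qE.
by apply/vspaceP=> x; rewrite memv_ker qE quo_map_ker.
Qed.
End SubQuot.

(** The universal property of the quotient: [e] presents [M] as [P] modulo
    [lker e]. *)
Lemma hom_factor_epi P M Y (e : 'Hom(P, M)) (h : 'Hom(P, Y)) :
  e \in homv P M -> limg e = fullv -> h \in homv P Y -> (lker e <= lker h)%VS ->
  exists2 k : 'Hom(M, Y), k \in homv M Y & (k \o e)%VF = h.
Proof.
move=> /homvP eA ef /homvP hA kk.
have kE x : (h \o e^-1)%VF (e x) = h x.
  apply/eqP; rewrite comp_lfunE -subr_eq0 -linearB -memv_ker; apply: (subvP kk).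
  by rewrite memv_ker linearB /= limg_lfunVK ?subrr // memv_img ?memvf.
exists (h \o e^-1)%VF; last by apply/lfunP=> x; rewrite comp_lfunE kE.
apply/homvP=> y a; have : y \in limg e by rewrite ef memvf.
by case/memv_imgP=> x _ ->; rewrite -eA !kE hA.
Qed.

Lemma hom_factor_mono P Z Y (j : 'Hom(Z, Y)) (h : 'Hom(P, Y)) :
  j \in homv Z Y -> lker j == 0%VS -> h \in homv P Y -> (limg h <= limg j)%VS ->
  exists2 k : 'Hom(P, Z), k \in homv P Z & (j \o k)%VF = h.
Proof.
move=> /homvP jA j0 /homvP hA ii.
have kE x : j ((j^-1 \o h)%VF x) = h x.
  by rewrite comp_lfunE limg_lfunVK //; apply: (subvP ii);
    rewrite memv_img ?memvf.
exists (j^-1 \o h)%VF; last by apply/lfunP=> x; rewrite comp_lfunE kE.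
apply/homvP=> x a; have /lker0P := j0; apply.
by rewrite jA !kE hA.
Qed.

(** Projectivity speaks of surjections only; this form, in which [g] need only
    reach the image of [f], follows by replacing [Y] with the submodule
    [limg g]. *)
Lemma proj_lift P X Y (g : 'Hom(X, Y)) (f : 'Hom(P, Y)) :
  projective P -> g \in homv X Y -> f \in homv P Y -> (limg f <= limg g)%VS ->
  exists2 h : 'Hom(P, X), h \in homv P X & (g \o h)%VF = f.
Proof.
move=> pP gA fA fg.
have [Z [j [jA j0 jE]]] := exists_submodule (submod_img gA).
have [|g' g'A g'E] := hom_factor_mono jA j0 gA; first by rewrite jE subvv.
have [|f' f'A f'E] := hom_factor_mono jA j0 fA; first by rewrite jE.
have g'f : limg g' = fullv.
  by apply/eqP; rewrite -(eq_limg_ker0 _ _ j0) -limg_comp g'E jE.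
have [h hA hE] := pP _ _ _ _ g'A g'f f'A.
by exists h; rewrite // -g'E -comp_lfunA hE.
Qed.

Lemma bij_lker M N (f : 'Hom(M, N)) : bijective f -> lker f == 0%VS.
Proof. by move=> /bij_inj fi; apply/lker0P. Qed.

Lemma bij_limg M N (f : 'Hom(M, N)) : bijective f -> limg f = fullv.
Proof.
case=> g _ gK; apply/vspaceP=> x; rewrite memvf.
by apply/memv_imgP; exists (g x); rewrite ?memvf ?gK.
Qed.

Lemma isoI M N (f : 'Hom(M, N)) :
  f \in homv M N -> lker f == 0%VS -> limg f = fullv -> iso M N.
Proof.
move=> fA f0 ff; exists f => //; exists (f^-1)%VF; first exact: lker0_lfunK.
by move=> x; apply: limg_lfunVK; rewrite ff memvf.
Qed.

Lemma iso_mutual M N : iso M N -> exists (f : 'Hom(M, N)) (g : 'Hom(N, M)),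
  [/\ f \in homv M N, g \in homv N M,
    (g \o f)%VF = \1%VF & (f \o g)%VF = \1%VF].
Proof.
case=> f fA bf; have f0 := bij_lker bf; have ff := bij_limg bf.
exists f, (f^-1)%VF; split=> //; first exact: homv_inv.
  exact: lker0_compVf.
by apply/lfunP=> x; rewrite comp_lfunE id_lfunE limg_lfunVK // ff memvf.
Qed.

Lemma mutual_iso M N (f : 'Hom(M, N)) (g : 'Hom(N, M)) :
  f \in homv M N -> (g \o f)%VF = \1%VF -> (f \o g)%VF = \1%VF -> iso M N.
Proof.
move=> fA gf fg; exists f => //; exists g => x.
  by rewrite -comp_lfunE gf id_lfunE.
by rewrite -comp_lfunE fg id_lfunE.
Qed.

Lemma iso_sym M N : iso M N -> iso N M.
Proof. by case/iso_mutual=> f [g [fA gA gf fg]];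
  apply: mutual_iso gA fg gf. Qed.

Lemma dim_iso M N : iso M N -> dim M = dim N.
Proof.
case=> f fA bf; rewrite -!dimvf -(bij_limg bf) limg_dim_eq //.
by rewrite (eqP (bij_lker bf)) capv0.
Qed.

Lemma limg_endo M (f : 'End(M)) : (lker f == 0%VS) = (limg f == fullv).
Proof.
have := limg_ker_dim f fullv; rewrite capfv => d.
apply/eqP/eqP=> [f0|ff].
  by apply/eqP; rewrite eqEdim subvf -d f0 dimv0 add0n leqnn.
by apply/eqP; rewrite -dimv_eq0 -(eqn_add2r (\dim (limg f))) d ff.
Qed.

Lemma zeromodP M : zeromod M <-> (fullv : {vspace M}) = 0%VS.
Proof.
split=> [M0 | M0 x]; last by apply/eqP; rewrite -memv0 -M0 memvf.
by apply/vspaceP=> x; rewrite memvf (M0 x) mem0v.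
Qed.

End Basics.

(** * Biproducts, direct summands and endomorphisms of indecomposables *)

Section Biproduct.
Variables (K : fieldType) (A : falgType K) (M N : rmodule A).

Definition dinl_fun (x : M) : (M * N)%type := (x, 0).
Fact dinl_linear : linear dinl_fun.
Proof.
move=> k x y; transitivity (k *: x + y, k *: (0 : N) + 0) => //.
by rewrite scaler0 addr0.
Qed.
HB.instance Definition _ := GRing.isLinear.Build _ _ _ _ _ dinl_linear.
Definition dinr_fun (x : N) : (M * N)%type := (0, x).
Fact dinr_linear : linear dinr_fun.
Proof.
move=> k x y; transitivity (k *: (0 : M) + 0, k *: x + y) => //.
by rewrite scaler0 addr0.
Qed.
HB.instance Definition _ := GRing.isLinear.Build _ _ _ _ _ dinr_linear.

Definition dinl : 'Hom(M, dsum M N) := linfun dinl_fun : 'Hom(M, (M * N)%type).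
Definition dinr : 'Hom(N, dsum M N) := linfun dinr_fun : 'Hom(N, (M * N)%type).
Definition dfst : 'Hom(dsum M N, M) := linfun fst : 'Hom((M * N)%type, M).
Definition dsnd : 'Hom(dsum M N, N) := linfun snd : 'Hom((M * N)%type, N).

Lemma dinlE x : dinl x = (x, 0). Proof. by rewrite /dinl lfunE. Qed.
Lemma dinrE x : dinr x = (0, x). Proof. by rewrite /dinr lfunE. Qed.
Lemma dfstE x : dfst x = x.1. Proof. by rewrite /dfst lfunE. Qed.
Lemma dsndE x : dsnd x = x.2. Proof. by rewrite /dsnd lfunE. Qed.
Lemma dsum_actE a (x : dsum M N) :
  ract (dsum M N) a x = (ract M a x.1, ract N a x.2).
Proof. exact: (lfunE (dsum_fun a)). Qed.

Lemma dinl_homv : dinl \in homv M (dsum M N).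
Proof. by apply/homvP=> x a; rewrite !dinlE dsum_actE /= linear0. Qed.
Lemma dinr_homv : dinr \in homv N (dsum M N).
Proof. by apply/homvP=> x a; rewrite !dinrE dsum_actE /= linear0. Qed.
Lemma dfst_homv : dfst \in homv (dsum M N) M.
Proof. by apply/homvP=> x a; rewrite !dfstE dsum_actE. Qed.
Lemma dsnd_homv : dsnd \in homv (dsum M N) N.
Proof. by apply/homvP=> x a; rewrite !dsndE dsum_actE. Qed.

Lemma dfst_inl : (dfst \o dinl)%VF = \1%VF.
Proof. by apply/lfunP=> x; rewrite comp_lfunE dfstE dinlE id_lfunE. Qed.
Lemma dsnd_inr : (dsnd \o dinr)%VF = \1%VF.
Proof. by apply/lfunP=> x; rewrite comp_lfunE dsndE dinrE id_lfunE. Qed.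
Lemma dsum_id : ((dinl \o dfst) + (dinr \o dsnd))%VF = \1%VF.
Proof.
apply/lfunP=> x; rewrite add_lfunE !comp_lfunE id_lfunE dfstE dsndE dinlE dinrE.
case: x => x y; transitivity (x + 0, 0 + y) => //.
by rewrite addr0 add0r.
Qed.
End Biproduct.
Arguments dinl {K A M N}.
Arguments dinr {K A M N}.
Arguments dfst {K A M N}.
Arguments dsnd {K A M N}.

Section Retracts.
Variables (K : fieldType) (A : falgType K).
Implicit Types M N L X Y Z P : rmodule A.

Lemma lker_comp_id M N (f : 'Hom(M, N)) (g : 'Hom(N, M)) :
  (g \o f)%VF = \1%VF -> lker f == 0%VS.
Proof.
move=> gf; apply/lker0P=> x y xy.
by rewrite -[x]id_lfunE -[y]id_lfunE -gf !comp_lfunE xy.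
Qed.

Lemma limg_comp_id M N (f : 'Hom(M, N)) (g : 'Hom(N, M)) :
  (g \o f)%VF = \1%VF -> limg g = fullv.
Proof.
move=> gf; apply/vspaceP=> x; rewrite memvf; apply/memv_imgP; exists (f x).
  exact: memvf.
by rewrite -comp_lfunE gf id_lfunE.
Qed.

(** It lets indecomposability, which speaks of external sums, act on pairs of
    complementary submodules. *)
Lemma decomp_iso M Z1 Z2 (i1 : 'Hom(Z1, M)) (i2 : 'Hom(Z2, M)) :
  i1 \in homv Z1 M -> i2 \in homv Z2 M -> lker i1 == 0%VS -> lker i2 == 0%VS ->
  (limg i1 :&: limg i2 = 0)%VS -> (limg i1 + limg i2 = fullv)%VS ->
  iso M (dsum Z1 Z2).
Proof.
move=> i1A i2A /lker0P i1i /lker0P i2i ic sf.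
apply: iso_sym; apply: (@isoI _ _ _ _ ((i1 \o dfst) + (i2 \o dsnd))%VF).
- by rewrite memvD // (homv_comp (dfst_homv _ _), homv_comp (dsnd_homv _ _)).
- rewrite -subv0; apply/subvP=> -[x y]; rewrite memv_ker memv0.
  rewrite add_lfunE !comp_lfunE dfstE dsndE /= addr_eq0 => /eqP xy.
  have : i1 x \in (limg i1 :&: limg i2)%VS.
    by rewrite memv_cap memv_img ?memvf // xy memvN memv_img ?memvf.
  rewrite ic memv0 => /eqP x0.
  have -> : x = 0 by apply: i1i; rewrite x0 linear0.
  have -> // : y = 0.
  by apply: i2i; rewrite linear0; apply/eqP; rewrite -oppr_eq0 -xy x0.
apply/vspaceP=> z; rewrite memvf; have : z \in (limg i1 + limg i2)%VS.
  by rewrite sf memvf.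
case/memv_addP=> _ /memv_imgP[x _ ->] [_ /memv_imgP[y _ ->] ->].
apply/memv_imgP; exists (x, y); rewrite ?memvf // add_lfunE !comp_lfunE.
by rewrite dfstE dsndE.
Qed.

Lemma summand_retract N M : summand N M ->
  exists (i : 'Hom(N, M)) (p : 'Hom(M, N)),
    [/\ i \in homv N M, p \in homv M N & (p \o i)%VF = \1%VF].
Proof.
case=> N' /iso_mutual[f [g [fA gA gf fg]]].
exists (g \o dinl)%VF, (dfst \o f)%VF; split.
- exact: homv_comp (dinl_homv _ _) gA.
- exact: homv_comp fA (dfst_homv _ _).
by rewrite -comp_lfunA (comp_lfunA f) fg comp_lfun1l dfst_inl.
Qed.

(** Together with [summand_retract], this replaces direct summands by
    retracts, which compose without any bookkeeping of complements: the
    complement is the kernel of [p]. *)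
Lemma retract_summand N M (i : 'Hom(N, M)) (p : 'Hom(M, N)) :
  i \in homv N M -> p \in homv M N -> (p \o i)%VF = \1%VF -> summand N M.
Proof.
move=> iA pA pi; have piE x : p (i x) = x by rewrite -comp_lfunE pi id_lfunE.
have [Z [j [jA j0 jE]]] := exists_submodule (submod_ker pA).
exists Z; apply: (decomp_iso iA jA (lker_comp_id pi) j0); rewrite jE.
  apply/eqP; rewrite -subv0; apply/subvP=> x; rewrite memv_cap memv0 memv_ker.
  by case/andP=> /memv_imgP[y _ ->]; rewrite piE => /eqP->; rewrite linear0.
apply/eqP; rewrite eqEsubv subvf; apply/subvP=> x _.
rewrite -[x](subrK (i (p x))) addrC memv_add ?memv_img ?memvf //.
by rewrite memv_ker linearB /= piE subrr.
Qed.

Lemma summand_trans M N L : summand M N -> summand N L -> summand M L.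
Proof.
move=> /summand_retract[i [p [iA pA pi]]] /summand_retract[j [q [jA qA qj]]].
apply: (retract_summand (homv_comp iA jA) (homv_comp qA pA)).
by rewrite -comp_lfunA (comp_lfunA q) qj comp_lfun1l.
Qed.

Lemma iso_summand M N : iso M N -> summand M N.
Proof. by case/iso_mutual=> f [g [fA gA gf _]]; apply: retract_summand gf. Qed.

Lemma indecomp_summand_iso X Y :
  indecomposable Y -> ~ zeromod X -> summand X Y -> iso X Y.
Proof.
move=> [_ Yi] X0 [X' YX]; have [//|X'0] := Yi _ _ YX.
case/iso_mutual: YX => f [g [fA gA gf fg]].
apply: (@mutual_iso _ _ _ _ (g \o dinl)%VF (dfst \o f)%VF).
- exact: homv_comp (dinl_homv _ _) gA.
- by rewrite -comp_lfunA (comp_lfunA f) fg comp_lfun1l dfst_inl.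
have lr : (dinl \o dfst)%VF = \1%VF :> 'End(dsum X X').
  rewrite -[RHS]dsum_id; apply/lfunP=> x; rewrite add_lfunE !comp_lfunE.
  by rewrite [dsnd x]X'0 linear0 addr0.
by rewrite -comp_lfunA (comp_lfunA dinl) lr comp_lfun1l gf.
Qed.

Fixpoint epow M (f : 'End(M)) m : 'End(M) :=
  if m is m'.+1 then (f \o epow f m')%VF else \1%VF.

Lemma epow_homv M (f : 'End(M)) m : f \in homv M M -> epow f m \in homv M M.
Proof. by move=> fA; elim: m => [|m /homv_comp/(_ fA)//]; apply: homv_id. Qed.

Lemma epowD M (f : 'End(M)) m1 m2 : epow f (m1 + m2) = (epow f m1 \o epow f
  m2)%VF.
Proof. by elim: m1 => [|m IH]; rewrite ?comp_lfun1l //= IH comp_lfunA. Qed.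

(** Chain conditions are used in this form: a family of subspaces, or of
    families of subspaces, has a member of largest dimension. *)
Lemma max_dim_exists (Q : nat -> Prop) b :
  (exists m, Q m) -> (forall m, Q m -> (m <= b)%N) ->
  exists2 m, Q m & forall m', Q m' -> (m' <= m)%N.
Proof.
move=> ex bd; have ex' : exists m, `[<Q m>] by case: ex => m /asboolP; exists m.
have bd' m : `[<Q m>] -> (m <= b)%N by move/asboolP/bd.
case: (ex_maxnP ex' bd') => m /asboolP Qm mx; exists m => // m' /asboolP.
exact: mx.
Qed.

(** Endomorphism rings of indecomposables are local. This is Fitting's lemma:
    when the kernels of the powers of [f] have stopped growing at [F = f^m],
    the module is the direct sum of [lker F] and [limg F], so that [f] is
    injective or nilpotent, and in the latter case [1 - f] is injective.
    Injective endomorphisms are bijective, as dimensions are finite. *)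
Lemma indecomp_endo X (f : 'End(X)) :
  indecomposable X -> f \in homv X X ->
  lker f == 0%VS \/ lker (\1 - f)%VF == 0%VS.
Proof.
move=> [X0 Xi] fA.
have [d [m md] dmax] : exists2 d, (exists m, \dim (lker (epow f m)) = d) &
    forall d', (exists m, \dim (lker (epow f m)) = d') -> (d' <= d)%N.
  apply: (@max_dim_exists _ (dim X));
    first by exists (\dim (lker (epow f 0))), 0%N.
  by move=> _ [m <-]; rewrite -dimvf dimvS ?subvf.
set F := epow f m in md; have FA : F \in homv X X by apply: epow_homv.
(* the kernel of [F \o F] is not larger than that of [F] by the choice of [m] *)
have FF x : F (F x) = 0 -> F x = 0.
  have sub : (lker F <= lker (epow f (m + m)))%VS.
    by apply/subvP=> y; rewrite !memv_ker epowD comp_lfunE => /eqP->;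
      rewrite linear0.
  have e : lker F = lker (epow f (m + m)).
    by apply/eqP; rewrite eqEdim sub md dmax //; exists (m + m)%N.
  by move/eqP=> FF; apply/eqP; rewrite -memv_ker e memv_ker epowD comp_lfunE.
have cap0 : (lker F :&: limg F = 0)%VS.
  apply/eqP; rewrite -subv0; apply/subvP=> x; rewrite memv_cap memv0 memv_ker.
  by case/andP=> /eqP Fx /memv_imgP[y _ xE]; rewrite xE FF // -xE.
have sumf : (lker F + limg F = fullv)%VS.
  apply/eqP; rewrite eqEdim subvf /= dimv_disjoint_sum //.
  by rewrite -{1}(limg_ker_dim F fullv) capfv.
have [Z1 [j1 [j1A j10 j1E]]] := exists_submodule (submod_ker FA).
have [Z2 [j2 [j2A j20 j2E]]] := exists_submodule (submod_img FA).
have /Xi : iso X (dsum Z1 Z2) by apply: (decomp_iso j1A j2A); rewrite ?j1E ?j2E.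
have z Z : zeromod Z -> forall j : 'Hom(Z, X), limg j = 0%VS.
  move=> Z0 j; move: Z0; by move/zeromodP->; rewrite limg0.
case=> [/z/(_ j1)|/z/(_ j2)]; rewrite ?j1E ?j2E => F0.
  left; rewrite -subv0 -F0; apply/subvP=> x; rewrite memv_ker => /eqP fx.
  have : (\dim (lker (epow f (m + 1))) <= \dim (lker F))%N.
    by rewrite md dmax //; exists (m + 1)%N.
  rewrite F0 dimv0 leqn0 dimv_eq0 => /eqP k0;
    rewrite -k0 memv_ker epowD comp_lfunE /=.
  by rewrite comp_lfunE id_lfunE fx linear0.
right; rewrite -subv0 -F0; apply/subvP=> x; rewrite memv_ker.
rewrite add_lfunE opp_lfunE id_lfunE subr_eq0 => /eqP fx.
suff <- : F x = x by rewrite memv_img ?memvf.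
by rewrite /F; elim: m {md F FA FF cap0 sumf j1E j2E F0} => [|m IH] /=;
  rewrite ?id_lfunE // comp_lfunE IH -fx.
Qed.
End Retracts.

(** * Krull-Schmidt, dimensions of Hom spaces and presentations *)

Section KrullSchmidt.
Variables (K : fieldType) (A : falgType K).
Implicit Types M N L X Y Z P R : rmodule A.

(** An injective [b \o a] is invertible, and its inverse turns [a] into a
    split monomorphism. *)
Lemma summand_of_inj_endo X Y (a : 'Hom(X, Y)) (b : 'Hom(Y, X)) :
  a \in homv X Y -> b \in homv Y X -> lker (b \o a)%VF == 0%VS -> summand X Y.
Proof.
move=> aA bA k0; have baA := homv_comp aA bA.
have uA := homv_inv baA k0 (eqP (etrans (esym (limg_endo _)) k0)).
apply: (retract_summand aA (homv_comp bA uA)).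
by rewrite -comp_lfunA lker0_compVf.
Qed.

(** Endomorphisms that factor through a different indecomposable lie in the
    radical of the local ring of endomorphisms of [X]. *)
Lemma one_sub_factor_inj X Y (a : 'Hom(X, Y)) (b : 'Hom(Y, X)) :
  indecomposable X -> indecomposable Y -> ~ iso X Y ->
  a \in homv X Y -> b \in homv Y X -> lker (\1 - (b \o a))%VF == 0%VS.
Proof.
move=> Xi Yi XY aA bA; have [k0|//] := indecomp_endo Xi (homv_comp aA bA).
case: XY; apply: indecomp_summand_iso => //; first by case: Xi.
exact: summand_of_inj_endo k0.
Qed.

(** The part of the Krull-Schmidt theorem that is needed: of the two
    endomorphisms of [X] through [Y] and through [Z], whose sum is the
    identity, one is injective as the ring is local. *)
Lemma summand_dsum X Y Z : indecomposable X -> summand X (dsum Y Z) ->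
  summand X Y \/ summand X Z.
Proof.
move=> Xi /summand_retract[i [p [iA pA pi]]].
have iYA := homv_comp iA (dfst_homv Y Z);
  have iZA := homv_comp iA (dsnd_homv Y Z).
have pYA := homv_comp (dinl_homv Y Z) pA;
  have pZA := homv_comp (dinr_homv Y Z) pA.
case: (indecomp_endo Xi (homv_comp iYA pYA)) => k0.
  by left; apply: summand_of_inj_endo k0.
right; apply: (summand_of_inj_endo iZA pZA).
suff <- : (\1 - ((p \o dinl) \o (dfst \o i)) = (p \o dinr) \o (dsnd \o i))%VF
  by [].
apply/lfunP=> x; rewrite add_lfunE opp_lfunE -pi !comp_lfunE -linearB.
congr (p _); have := dsum_id Y Z => /lfunP/(_ (i x)).
by rewrite add_lfunE !comp_lfunE id_lfunE => {1}<-; rewrite addrC addKr.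
Qed.

End KrullSchmidt.

Notation hdim M N := (\dim (homv M N)).

Section HomDim.
Variables (K : fieldType) (A : falgType K).
Implicit Types M N L X Y Z P R : rmodule A.

Section Precomp.
Variables (M N Y : rmodule A) (d : 'Hom(M, N)).
Definition precomp_fun (h : 'Hom(N, Y)) : 'Hom(M, Y) := (h \o d)%VF.
Fact precomp_linear : linear precomp_fun.
Proof. by move=> k f g; rewrite /precomp_fun comp_lfunDl comp_lfunZl. Qed.
HB.instance Definition _ := GRing.isLinear.Build _ _ _ _ _ precomp_linear.
Definition precomp : 'Hom('Hom(N, Y), 'Hom(M, Y)) := linfun precomp_fun.
Lemma precompE h : precomp h = (h \o d)%VF. Proof.
  by rewrite /precomp lfunE. Qed.
End Precomp.

(** For a minimal projective presentation [d] of [M], this says that the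
    cokernel of Hom(P0, Y) -> Hom(P1, Y), which is dual to Hom(Y, tau M),
    vanishes. *)
Definition factors P1 P0 (d : 'Hom(P1, P0)) Y :=
  forall f, f \in homv P1 Y -> exists2 h, h \in homv P0 Y & f = (h \o d)%VF.

Section Presentation.
Variables (M P1 P0 : rmodule A) (d : 'Hom(P1, P0)) (e : 'Hom(P0, M)).
Hypothesis dA : d \in homv P1 P0.
Hypothesis eA : e \in homv P0 M.
Hypothesis ef : limg e = fullv.
Hypothesis de : limg d = lker e.

(** Left exactness of Hom(-, Y), counted. *)
Lemma hdim_pres Y : hdim P0 Y = (hdim M Y + \dim (precomp Y d @: homv P0 Y))%N.
Proof.
rewrite -(limg_ker_dim (precomp Y d) (homv P0 Y)); congr addn.
have <- : (precomp Y e @: homv M Y)%VS = (homv P0 Y :&: lker (precomp Y d))%VS.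
  apply/vspaceP=> h; apply/memv_imgP/idP => [[k kA ->]|].
    rewrite memv_cap precompE homv_comp // memv_ker precompE -comp_lfunA.
    apply/eqP; apply/lfunP=> x; rewrite !comp_lfunE zero_lfunE.
    have : d x \in lker e by rewrite -de memv_img ?memvf.
    by rewrite memv_ker => /eqP->; rewrite linear0.
  rewrite memv_cap memv_ker precompE => /andP[hA /eqP hd].
  have kk : (lker e <= lker h)%VS.
    rewrite -de; apply/subvP=> _ /memv_imgP[x _ ->].
    by rewrite memv_ker -comp_lfunE hd zero_lfunE.
  by have [k kA kE] := hom_factor_epi eA ef hA kk; exists k; rewrite ?precompE.
rewrite limg_dim_eq //; apply/eqP; rewrite -subv0; apply/subvP=> k.
rewrite memv_cap memv0 memv_ker precompE => /andP[_ /eqP ke].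
apply/eqP/lfunP=> y; have : y \in limg e by rewrite ef memvf.
by case/memv_imgP=> x _ ->; rewrite -comp_lfunE ke !zero_lfunE.
Qed.

Fact precomp_img_sub Y : (precomp Y d @: homv P0 Y <= homv P1 Y)%VS.
Proof. by apply/subvP=> _ /memv_imgP[h hA ->]; rewrite precompE homv_comp. Qed.

Lemma hdim_pres_le Y : (hdim P0 Y <= hdim M Y + hdim P1 Y)%N.
Proof. by rewrite hdim_pres leq_add2l dimvS // precomp_img_sub. Qed.

Lemma hdim_pres_eq Y : factors d Y -> hdim P0 Y = (hdim M Y + hdim P1 Y)%N.
Proof.
move=> fd; rewrite hdim_pres; congr (_ + \dim _)%N; apply/eqP.
rewrite eqEsubv precomp_img_sub; apply/subvP=> f /fd[h hA ->].
by rewrite -precompE memv_img.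
Qed.
End Presentation.

Lemma hdim_epi M N (e : 'Hom(M, N)) Y :
  e \in homv M N -> limg e = fullv -> (hdim N Y <= hdim M Y)%N.
Proof.
move=> eA ef; have [Z [j [jA _ jE]]] := exists_submodule (submod_ker eA).
by rewrite (hdim_pres eA ef jE) leq_addr.
Qed.

(** Additivity is the case of the split sequence M -> M + N -> N in
    [hdim_pres_eq]. *)
Lemma hdim_dsum M N Y : hdim (dsum M N) Y = (hdim M Y + hdim N Y)%N.
Proof.
rewrite addnC; apply: (@hdim_pres_eq _ _ _ dinl dsnd).
- exact: dinl_homv.
- exact: dsnd_homv.
- exact: limg_comp_id (dsnd_inr _ _).
- apply/vspaceP=> x; rewrite memv_ker dsndE; apply/memv_imgP/eqP.
    by case=> y _ ->; rewrite dinlE.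
  by case: x => x y /= ->; exists x; rewrite ?memvf ?dinlE.
move=> f fA; exists (f \o dfst)%VF; first exact: homv_comp (dfst_homv _ _) fA.
by rewrite -comp_lfunA dfst_inl comp_lfun1r.
Qed.

Lemma hdim_zero M Y : zeromod M -> hdim M Y = 0%N.
Proof.
move=> M0; apply/eqP; rewrite dimv_eq0 -subv0; apply/subvP=> f _; rewrite memv0.
by apply/eqP/lfunP=> x; rewrite (M0 x) !linear0.
Qed.

Lemma zeromod_rzero : zeromod (rzero A).
Proof. by move=> x; rewrite [LHS]thinmx0 [RHS]thinmx0. Qed.

Lemma hdim_dsums s Y : hdim (dsums s) Y = (\sum_(M <- s) hdim M Y)%N.
Proof.
elim: s => [|M s IH]; first by rewrite big_nil hdim_zero //;
  exact: zeromod_rzero.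
by rewrite big_cons -IH -hdim_dsum.
Qed.

Lemma hdim_proj_sum n (P : 'I_n -> rmodule A) a Y :
  hdim (proj_sum P a) Y = (\sum_i a i * hdim (P i) Y)%N.
Proof.
rewrite /proj_sum hdim_dsums big_flatten big_map big_enum /=.
by apply: eq_bigr => i _; rewrite big_nseq iter_addn_0 mulnC.
Qed.

(** The image of [u] and the kernel of [e] together span [P0]. By this lemma,
    maps between projective covers that induce isomorphisms are isomorphisms.
    *)
Lemma superfluous_epi P0 M (e : 'Hom(P0, M)) (u : 'End(P0)) :
  e \in homv P0 M -> superfluous (lker e) -> u \in homv P0 P0 ->
  limg (e \o u)%VF = limg e -> limg u = fullv.
Proof.
move=> eA sK uA eu; apply: sK; first exact: submod_img.
apply/eqP; rewrite eqEsubv subvf; apply/subvP=> x _.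
have : e x \in limg (e \o u)%VF by rewrite eu memv_img ?memvf.
case/memv_imgP=> y _; rewrite comp_lfunE => exy.
rewrite -[x](subrK (u y)) memv_add ?memv_img ?memvf //.
by rewrite memv_ker linearB /= exy subrr.
Qed.

Section Comparison.
Variables (M P1 P0 X R1 R0 : rmodule A).
Variables (d : 'Hom(P1, P0)) (e : 'Hom(P0, M)).
Variables (d' : 'Hom(R1, R0)) (e' : 'Hom(R0, X)).
Variables (i : 'Hom(X, M)) (p : 'Hom(M, X)).

(** The comparison theorem for minimal presentations: the maps that realise
    [X] as a retract of [M] lift to maps between the presentations, and by
    minimality the lifted composites on [R0] and [R1] are onto, hence
    bijective. Both the uniqueness of minimal presentations and their
    compatibility with summands are consequences. *)
Lemma pres_retract : min_proj_pres d e -> min_proj_pres d' e' ->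
  i \in homv X M -> p \in homv M X -> (p \o i)%VF = \1%VF ->
  exists (i0 : 'Hom(R0, P0)) (i1 : 'Hom(R1, P1))
         (p0 : 'Hom(P0, R0)) (p1 : 'Hom(P1, R1)),
  [/\ [/\ i0 \in homv R0 P0, i1 \in homv R1 P1, p0 \in homv P0 R0
        & p1 \in homv P1 R1],
      (d \o i1 = i0 \o d')%VF, limg (p0 \o i0)%VF = fullv
    & limg (p1 \o i1)%VF = fullv].
Proof.
case=> -[pP1 pP0] [dA eA] [ef de] [sE sD].
case=> -[pR1 pR0] [d'A e'A] [e'f d'e'] [sE' sD'] iA pA pi.
have dK x : e (d x) = 0.
  by apply/eqP; rewrite -memv_ker -de memv_img ?memvf.
have d'K x : e' (d' x) = 0.
  by apply/eqP; rewrite -memv_ker -d'e' memv_img ?memvf.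
have [|i0 i0A i0E] := proj_lift pR0 eA (homv_comp e'A iA);
  first by rewrite ef subvf.
have [|p0 p0A p0E] := proj_lift pP0 e'A (homv_comp eA pA);
  first by rewrite e'f subvf.
have [|i1 i1A i1E] := proj_lift pR1 dA (homv_comp d'A i0A).
  rewrite de; apply/subvP=> _ /memv_imgP[x _ ->]; rewrite memv_ker.
  by rewrite -comp_lfunE comp_lfunA i0E !comp_lfunE d'K linear0.
have [|p1 p1A p1E] := proj_lift pP1 d'A (homv_comp dA p0A).
  rewrite d'e'; apply/subvP=> _ /memv_imgP[x _ ->]; rewrite memv_ker.
  by rewrite -comp_lfunE comp_lfunA p0E !comp_lfunE dK linear0.
exists i0, i1, p0, p1.
have u0E : (e' \o (p0 \o i0))%VF = e'.
  by rewrite comp_lfunA p0E -comp_lfunA i0E comp_lfunA pi comp_lfun1l.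
have u0f : limg (p0 \o i0)%VF = fullv.
  by apply: (superfluous_epi e'A sE' (homv_comp i0A p0A)); rewrite u0E.
split=> //; apply: (superfluous_epi d'A sD' (homv_comp i1A p1A)).
have -> : (d' \o (p1 \o i1) = (p0 \o i0) \o d')%VF.
  by rewrite comp_lfunA p1E -comp_lfunA i1E comp_lfunA.
(* [p0 \o i0] is bijective and commutes with [e'], so it preserves the kernel of
   [e'], which is the image of [d'] *)
have u00 : lker (p0 \o i0)%VF == 0%VS by rewrite limg_endo u0f.
rewrite limg_comp d'e'; apply/eqP; rewrite eqEdim; apply/andP; split.
  apply/subvP=> _ /memv_imgP[x xk ->]; rewrite memv_ker -comp_lfunE u0E.
  by rewrite -memv_ker.
by rewrite limg_dim_eq // (eqP u00) capv0.
Qed.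
End Comparison.

(** It allows the hypothesis on tau, known for one presentation of the whole
    module, to be used for any minimal presentation of any summand. *)
Lemma factors_retract M P1 P0 (d : 'Hom(P1, P0)) (e : 'Hom(P0, M))
    X R1 R0 (d' : 'Hom(R1, R0)) (e' : 'Hom(R0, X)) Y :
  min_proj_pres d e -> min_proj_pres d' e' -> summand X M ->
  factors d Y -> factors d' Y.
Proof.
move=> pd pd' /summand_retract[i [p [iA pA pi]]] fd f fA.
have [i0 [i1 [p0 [p1 [[i0A i1A p0A p1A] sq _ u1f]]]]] :=
  pres_retract pd pd' iA pA pi.
have u10 : lker (p1 \o i1)%VF == 0%VS by rewrite limg_endo u1f.
have vA := homv_inv (homv_comp i1A p1A) u10 u1f.
have [h hA hE] := fd _ (homv_comp p1A (homv_comp vA fA)).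
exists (h \o i0)%VF; first exact: homv_comp hA.
rewrite -comp_lfunA -sq comp_lfunA -hE -!comp_lfunA.
by rewrite lker0_compVf // comp_lfun1r.
Qed.

Lemma factors_summand P1 P0 (d : 'Hom(P1, P0)) Y M :
  summand Y M -> factors d M -> factors d Y.
Proof.
move=> /summand_retract[i [p [iA pA pi]]] fd f fA.
have [h hA hE] := fd _ (homv_comp fA iA).
exists (p \o h)%VF; first exact: homv_comp pA.
by rewrite -comp_lfunA -hE comp_lfunA pi comp_lfun1l.
Qed.

Lemma epi_left M N L (f : 'Hom(N, L)) (g : 'Hom(M, N)) :
  limg (f \o g)%VF = fullv -> limg f = fullv.
Proof.
by move=> fg; apply/eqP; rewrite eqEsubv subvf -fg limg_comp limgS ?subvf.
Qed.

Lemma hdim_pres_summand M P1 P0 (d : 'Hom(P1, P0)) (e : 'Hom(P0, M))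
    X R1 R0 (d' : 'Hom(R1, R0)) (e' : 'Hom(R0, X)) Y :
  min_proj_pres d e -> min_proj_pres d' e' -> summand X M ->
  (hdim R0 Y <= hdim P0 Y)%N /\ (hdim R1 Y <= hdim P1 Y)%N.
Proof.
move=> pd pd' /summand_retract[i [p [iA pA pi]]].
have [i0 [i1 [p0 [p1 [[i0A i1A p0A p1A] _ u0f u1f]]]]] :=
  pres_retract pd pd' iA pA pi.
split; first exact: hdim_epi p0A (epi_left u0f).
exact: hdim_epi p1A (epi_left u1f).
Qed.

Lemma hdim_pres_iso M P1 P0 (d : 'Hom(P1, P0)) (e : 'Hom(P0, M))
    X R1 R0 (d' : 'Hom(R1, R0)) (e' : 'Hom(R0, X)) Y :
  min_proj_pres d e -> min_proj_pres d' e' -> iso X M ->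
  hdim P0 Y = hdim R0 Y /\ hdim P1 Y = hdim R1 Y.
Proof.
move=> pd pd' XM; have [a b] := hdim_pres_summand Y pd pd' (iso_summand XM).
have [a' b'] := hdim_pres_summand Y pd' pd (iso_summand (iso_sym XM)).
by split; apply/eqP; rewrite eqn_leq ?a ?a' ?b ?b'.
Qed.
End HomDim.

(** * Traces of families of modules *)

Section Trace.
Variables (K : fieldType) (A : falgType K).
Implicit Types M N L X Y Z P R : rmodule A.

(** [Y] belongs to Fac of the modules [X i] with [B i], that is, is a quotient
    of a finite direct sum of copies of them, if and only if its trace is
    [fullv]. The basis of Hom(X i, Y) keeps the sum finite. *)
Definition trace (I : finType) (B : pred I) (X : I -> rmodule A) Y :
    {vspace Y} :=
  (\sum_(i | B i) \sum_(k < hdim (X i) Y) limg (vbasis (homv (X i) Y))`_k)%VS.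

Section TraceTheory.
Variables (I : finType) (B : pred I) (X : I -> rmodule A) (Y : rmodule A).
Notation tr := (trace B X Y).

Lemma limg_trace i (f : 'Hom(X i, Y)) :
  B i -> f \in homv (X i) Y -> (limg f <= tr)%VS.
Proof.
move=> Bi fA; apply: subv_trans (sumv_sup i Bi (subvv _)).
apply/subvP=> _ /memv_imgP[x _ ->]; rewrite (coord_vbasis fA) sum_lfunE.
apply: memv_sumr => k _; rewrite scale_lfunE memvZ //.
by rewrite memv_img ?memvf.
Qed.

Fact vbasis_homv i (k : 'I_(hdim (X i) Y)) :
  (vbasis (homv (X i) Y))`_k \in homv (X i) Y.
Proof. by apply: vbasis_mem; rewrite mem_nth ?size_tuple. Qed.

Lemma trace_sub (U : {vspace Y}) :
  (forall i (f : 'Hom(X i, Y)),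
     B i -> f \in homv (X i) Y -> (limg f <= U)%VS) ->
  (tr <= U)%VS.
Proof.
move=> h; apply/subv_sumP=> i Bi; apply/subv_sumP=> k _.
by apply: h => //; apply: vbasis_homv.
Qed.

Lemma submod_trace : submod tr.
Proof.
by apply: submod_sum => i _; apply: submod_sum => k _;
  apply/submod_img/vbasis_homv.
Qed.

(** The map lifts to the direct sum of the submodules [U] and [V], which
    surjects onto [U + V]. *)
Lemma proj_split P (U V : {vspace Y}) (g : 'Hom(P, Y)) :
  projective P -> submod U -> submod V -> g \in homv P Y ->
    (limg g <= U + V)%VS ->
  exists (g1 g2 : 'Hom(P, Y)), [/\ g1 \in homv P Y, g2 \in homv P Y,
    (limg g1 <= U)%VS, (limg g2 <= V)%VS & g = g1 + g2].
Proof.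
move=> pP sU sV gA gUV.
have [Z1 [j1 [j1A _ j1E]]] := exists_submodule sU.
have [Z2 [j2 [j2A _ j2E]]] := exists_submodule sV.
have sumA : ((j1 \o dfst) + (j2 \o dsnd))%VF \in homv (dsum Z1 Z2) Y.
  by rewrite memvD // (homv_comp (dfst_homv _ _), homv_comp (dsnd_homv _ _)).
have [|h hA hE] := proj_lift pP sumA gA.
  apply: subv_trans gUV _; rewrite -j1E -j2E.
  apply/subvP=> _ /memv_addP[_ /memv_imgP[x _ ->] [_ /memv_imgP[y _ ->] ->]].
  apply/memv_imgP; exists (x, y); rewrite ?memvf // add_lfunE !comp_lfunE.
  by rewrite dfstE dsndE.
exists (j1 \o (dfst \o h))%VF, (j2 \o (dsnd \o h))%VF; split.
- exact: homv_comp (homv_comp hA (dfst_homv _ _)) j1A.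
- exact: homv_comp (homv_comp hA (dsnd_homv _ _)) j2A.
- by rewrite limg_comp -j1E limgS ?subvf.
- by rewrite limg_comp -j2E limgS ?subvf.
by rewrite -hE comp_lfunDl !comp_lfunA.
Qed.

(** A map from a projective into the trace is a sum of maps that factor
    through the modules [X i]; hence an additive property of maps can be
    checked on such composites. *)
Lemma proj_trace_ind P (C : 'Hom(P, Y) -> Prop) :
  projective P -> C 0 -> (forall f g, C f -> C g -> C (f + g)) ->
  (forall i (h : 'Hom(P, X i)) (g : 'Hom(X i, Y)), B i ->
     h \in homv P (X i) -> g \in homv (X i) Y -> C (g \o h)%VF) ->
  forall g, g \in homv P Y -> (limg g <= tr)%VS -> C g.
Proof.
move=> pP C0 CD Cc.
pose G (U : {vspace Y}) :=
  submod U /\ forall g, g \in homv P Y -> (limg g <= U)%VS -> C g.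
suff [] : G tr by [].
have G0 : G 0%VS.
  split=> [|g _]; first exact: submod0.
  move=> g0; suff -> : g = 0 by [].
  apply/lfunP=> x; rewrite zero_lfunE; apply/eqP; rewrite -memv0.
  by apply: (subvP g0); rewrite memv_img ?memvf.
have GD U V : G U -> G V -> G (U + V)%VS.
  move=> [sU gU] [sV gV]; split=> [|g gA gUV]; first exact: submod_add.
  have [g1 [g2 [g1A g2A g1U g2V ->]]] := proj_split pP sU sV gA gUV.
  by apply: CD; [apply: gU|apply: gV].
rewrite /trace; elim/big_ind: _ => // i Bi; elim/big_ind: _ => // k _.
split=> [|g gA gs]; first exact/submod_img/vbasis_homv.
have [h hA <-] := proj_lift pP (vbasis_homv k) gA gs.
by apply: Cc => //; apply: vbasis_homv.
Qed.
End TraceTheory.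

Lemma trace_self (I : finType) (B : pred I) (X : I -> rmodule A) i :
  B i -> trace B X (X i) = fullv.
Proof.
move=> Bi; apply/eqP; rewrite eqEsubv subvf -{1}(lim1g fullv).
by apply: limg_trace => //; apply: homv_id.
Qed.

Lemma trace_quotient (I : finType) (B : pred I) (X : I -> rmodule A) Y Z
    (q : 'Hom(Y, Z)) : q \in homv Y Z -> limg q = fullv ->
  trace B X Y = fullv -> trace B X Z = fullv.
Proof.
move=> qA qf tf; apply/eqP; rewrite eqEsubv subvf -qf /=; apply/subvP.
move=> _ /memv_imgP[y _ ->]; rewrite memv_preim; move: y (memvf y); apply/subvP.
rewrite -tf; apply: trace_sub => i f Bi fA; apply/subvP=> _ /memv_imgP[x _ ->].
rewrite -memv_preim -comp_lfunE.
apply: (subvP (limg_trace Bi (homv_comp fA qA))).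
by rewrite memv_img ?memvf.
Qed.

End Trace.

(** Coordinates of the projection onto a complement of [U] give the
    functional. *)
Lemma exists_functional (K : fieldType) (V : vectType K) (U : {vspace V}) f :
  f \notin U ->
  exists l : 'Hom(V, K^o), (forall u, u \in U -> l u = 0) /\ l f != 0.
Proof.
move=> fU; have cap : (U^C :&: U = 0)%VS by rewrite capvC capv_compl.
have fE x : x = daddv_pi U^C U x + daddv_pi U U^C x.
  by rewrite daddv_pi_add // addvC addv_complf memvf.
have w0 : daddv_pi U^C U f != 0.
  by apply: contra fU => /eqP w0; rewrite [f]fE w0 add0r memv_pi.
have [k kn] : exists k, coord (vbasis fullv) k (daddv_pi U^C U f) != 0.
  apply/existsP; apply: contraR w0; rewrite negb_exists => /forallP c0.
  apply/eqP; rewrite (coord_vbasis (memvf (daddv_pi U^C U f))).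
  by apply: big1 => k _; rewrite (eqP (negPn (c0 k))) scale0r.
have lE : linear (fun x => coord (vbasis fullv) k (daddv_pi U^C U x) : K^o).
  by move=> a x y; rewrite !linearP.
exists (linfun (fun x => coord (vbasis fullv) k (daddv_pi U^C U x) : K^o)).
split=> [u uU|]; rewrite linfun_linearE //.
suff -> : daddv_pi U^C U u = 0 by rewrite linear0.
apply/eqP; rewrite -memv0 -cap memv_cap memv_pi /=.
have -> : daddv_pi U^C U u = u - daddv_pi U U^C u by rewrite {2}[u]fE addrK.
by rewrite memvB // memv_pi.
Qed.

(** * The Auslander-Reiten translation *)

Section Tensor.
Variables (K : fieldType) (A : falgType K).
Implicit Types M N L X Y Z P R : rmodule A.

(** The image of the tensor of [y] and [phi] under the canonical map from Y
    (x)_A Hom(P, A) to Hom(P, Y). *)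
Definition rank1 P Y (y : Y) (phi : star P) : 'Hom(P, Y) :=
  linfun (fun x => ract Y ((vsval phi : 'Hom(P, regular A)) x) y).

Lemma rank1E P Y (y : Y) (phi : star P) x :
  rank1 y phi x = ract Y ((vsval phi : 'Hom(P, regular A)) x) y.
Proof.
apply: (@linfun_linearE _ _ _
  (fun x => ract Y ((vsval phi : 'Hom(P, regular A)) x) y)).
by move=> k u v; rewrite !linearP add_lfunE scale_lfunE.
Qed.

Lemma star_homvP P (phi : star P) x a :
  (vsval phi : 'Hom(P, regular A)) (ract P a x) = (vsval phi : 'Hom(P,
    regular A)) x * a.
Proof.
have /homvP-> := subvsP (phi : subvs_of (homv P (regular A))).
exact: (lfunE (_ \o* idfun)).
Qed.

Lemma star_lactE P a (phi : star P) x :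
  (vsval (lact (star P) a phi) : 'Hom(P, regular A)) x =
  a * (vsval phi : 'Hom(P, regular A)) x.
Proof.
have -> : lact (star P) a phi = star_fun a phi by exact: (lfunE (star_fun a)).
by rewrite star_fun_val comp_lfunE lfunE.
Qed.

Lemma rank1_homv P Y (y : Y) (phi : star P) : rank1 y phi \in homv P Y.
Proof.
by apply/homvP=> x a; rewrite !rank1E star_homvP ractM comp_lfunE.
Qed.

Lemma rank1_act P Y (y : Y) (phi : star P) a :
  rank1 (ract Y a y) phi = rank1 y (lact (star P) a phi).
Proof.
by apply/lfunP=> x; rewrite !rank1E star_lactE ractM comp_lfunE.
Qed.

Lemma rank1_star_map P1 P0 Y (d : 'Hom(P1, P0)) (y : Y) (psi : star P0) :
  d \in homv P1 P0 -> rank1 y (star_map d psi) = (rank1 y psi \o d)%VF.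
Proof.
by move=> dA; apply/lfunP=> x;
  rewrite comp_lfunE !rank1E star_mapE // comp_lfunE.
Qed.

Lemma rank1_linearl P Y (phi : star P) : linear (fun y : Y => rank1 y phi).
Proof.
move=> k y z; apply/lfunP=> x.
by rewrite add_lfunE scale_lfunE !rank1E linearP.
Qed.

Lemma rank1_linearr P Y (y : Y) : linear (fun phi : star P => rank1 y phi).
Proof.
move=> k f g; apply/lfunP=> x; rewrite add_lfunE scale_lfunE !rank1E.
have -> : vsval (k *: f + g) = k *: (vsval f : 'Hom(P, regular A)) + vsval g.
  by rewrite linearP.
by rewrite add_lfunE scale_lfunE linearP add_lfunE scale_lfunE.
Qed.

Lemma regular_factor P Y (g : 'Hom(regular A, Y)) (h : 'Hom(P, regular A))
    (hA : h \in homv P (regular A)) :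
  g \in homv (regular A) Y -> (g \o h)%VF = rank1 (g 1) (Subvs hA : star P).
Proof.
move=> /homvP gA; apply/lfunP=> x; rewrite comp_lfunE rank1E -gA; congr (g _).
have -> : ract (regular A) (h x) 1 = 1 * h x by exact: (lfunE (_ \o* idfun)).
by rewrite mul1r.
Qed.

(** Each element [y] is the image of 1 under the map a |-> y a. With
    [proj_trace_ind] this yields the dual basis lemma: maps out of a
    projective are sums of maps [rank1 y phi]. *)
Lemma trace_regular Y : trace predT (fun _ : unit => regular A) Y = fullv.
Proof.
apply/eqP; rewrite eqEsubv subvf; apply/subvP=> y _.
have gl : linear (fun a : A => ract Y a y).
  by move=> k a b; rewrite linearP add_lfunE scale_lfunE.
pose g : 'Hom(regular A, Y) := linfun (fun a : A => ract Y a y) : 'Hom(A, Y).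
have gE a : g a = ract Y a y by exact: linfun_linearE.
have gA : g \in homv (regular A) Y.
  apply/homvP=> x a; have -> : ract (regular A) a x = x * a.
    exact: (lfunE (_ \o* idfun)).
  by rewrite !gE ractM comp_lfunE.
apply: (subvP (@limg_trace _ _ _ predT (fun _ => regular A) _ tt _ isT gA)).
have -> : y = g 1 by rewrite gE ract1 id_lfunE.
by rewrite memv_img ?memvf.
Qed.

Section AuslanderReiten.
Variables (P1 P0 Y : rmodule A) (d : 'Hom(P1, P0)) (L : lmodule A).
Variable pi : 'Hom(star P1, L).
Hypothesis pP1 : projective P1.
Hypothesis dA : d \in homv P1 P0.
Hypothesis piA : lhom pi.
Hypothesis pif : limg pi = fullv.
Hypothesis pik : lker pi = limg (star_map d).
Hypothesis Y0 : homv Y (kdual L) = 0%VS.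

(** The needed half of the Auslander-Reiten duality between Hom(Y, D Tr M) and
    the cokernel of Hom(P0, Y) -> Hom(P1, Y). A map [f] that does not factor
    through [d] is detected by a functional [l] that vanishes on all maps that
    do. Then (y, phi) |-> l (rank1 y phi) is balanced over A and vanishes on
    the image of Hom(P0, A), so it defines a homomorphism from [Y] to the dual
    of [L]. This homomorphism is zero by hypothesis, so [l] vanishes on all
    maps [rank1 y phi]; these span Hom(P1, Y) by the dual basis lemma. *)
Lemma factors_of_kdual : factors d Y.
Proof.
move=> f fA; case: (boolP (f \in (precomp Y d @: homv P0 Y)%VS)) => [|fW].
  by case/memv_imgP=> h hA ->; exists h; rewrite ?precompE.
have [l [l0 lf]] := exists_functional fW.
suff lA g : g \in homv P1 Y -> l g = 0 by rewrite lA ?eqxx in lf.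
suff l1 y (phi : star P1) : l (rank1 y phi) = 0.
  move=> gA.
  apply: (@proj_trace_ind _ _ _ predT (fun _ : unit => regular A) Y P1
            (fun g => l g = 0)) => //.
  - by rewrite linear0.
  - by move=> u v /= u0 v0; rewrite linearD /= u0 v0 addr0.
  - by move=> [] h g' _ hA g'A; rewrite regular_factor.
  by rewrite trace_regular subvf.
have bl z : linear (fun phi : star P1 => l (rank1 z phi) : K^o).
  by move=> k u v; rewrite rank1_linearr linearP.
pose b z : 'Hom(star P1, K^o) := linfun (fun phi => l (rank1 z phi) : K^o).
have bE z u : b z u = l (rank1 z u) by exact: linfun_linearE.
pose T z : 'Hom(L, K^o) := (b z \o pi^-1)%VF.
(* well defined: the kernel of [pi] is the image of Hom(P0, A),
  where [l] vanishes *)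
have TE z u : T z (pi u) = l (rank1 z u).
  rewrite comp_lfunE -bE; apply/eqP; rewrite -subr_eq0 -linearB.
  have : pi^-1%VF (pi u) - u \in lker pi.
    by rewrite memv_ker linearB /= limg_lfunVK ?subrr // memv_img ?memvf.
  rewrite pik => /memv_imgP[psi _ ->];
    rewrite /= bE rank1_star_map // -precompE.
  by rewrite l0 // memv_img // rank1_homv.
have Tl : linear T.
  move=> k u v; apply/lfunP=> x; rewrite add_lfunE scale_lfunE.
  have [w ->] := limg_surj pif x.
  by rewrite !TE rank1_linearl linearP.
pose t : 'Hom(Y, kdual L) := linfun T : 'Hom(Y, 'Hom(L, K^o)).
have tE z : t z = T z by exact: linfun_linearE.
have tA : t \in homv Y (kdual L).
  apply/homvP=> z a; rewrite !tE.
  have -> : ract (kdual L) a (T z) = (T z \o lact L a)%VF.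
    exact: (lfunE (dual_fun a)).
  apply/lfunP=> x; have [w ->] := limg_surj pif x.
  by rewrite [RHS]comp_lfunE -piA !TE rank1_act.
rewrite -TE -tE; move: tA; rewrite Y0 memv0 => /eqP->.
by rewrite zero_lfunE [LHS]zero_lfunE.
Qed.
End AuslanderReiten.

Lemma factors_of_tau M tM Y : is_tau M tM -> homv Y tM = 0%VS ->
  exists (P1 P0 : rmodule A) (d : 'Hom(P1, P0)) (e : 'Hom(P0, M)),
    min_proj_pres d e /\ factors d Y.
Proof.
case=> L [P1 [P0 [d [e [pd [pi [piA pif pik]]]]]]] /iso_mutual[f [g [fA gA gf
  fg]]] Y0.
exists P1, P0, d, e; split=> //.
have [[pP1 _] [dA _] _ _] := pd.
apply: (factors_of_kdual pP1 dA piA pif pik).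
apply/eqP; rewrite -subv0; apply/subvP=> h hA.
have : (g \o h)%VF \in homv Y tM by apply: homv_comp gA.
rewrite Y0 !memv0 => /eqP gh.
by rewrite -[h]comp_lfun1l -fg -comp_lfunA gh comp_lfun0r.
Qed.
End Tensor.

(** * Tops of projectives and mutual generation *)

Section Tops.
Variables (K : fieldType) (A : falgType K).
Implicit Types M N L X Y Z P R : rmodule A.

Lemma hdim0P X Y :
  reflect (forall f, f \in homv X Y -> f = 0) (hdim X Y == 0%N).
Proof.
rewrite dimv_eq0; apply: (iffP eqP) => [h0 f|h0];
  first by rewrite h0 memv0 => /eqP.
by apply/eqP; rewrite -subv0; apply/subvP=> f /h0->; rewrite mem0v.
Qed.

Lemma exists_maximal_submod X : ~ zeromod X -> exists V : {vspace X},
  [/\ submod V, V <> fullv & forall W, submod W -> (V <= W)%VS ->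
    W <> fullv -> W = V].
Proof.
move=> X0.
have [d [V [sV Vf dV]] dmax] : exists2 d,
    (exists V : {vspace X}, [/\ submod V, V <> fullv & \dim V = d]) &
    forall d', (exists V : {vspace X}, [/\ submod V,
      V <> fullv & \dim V = d']) ->
      (d' <= d)%N.
  apply: (@max_dim_exists _ (dim X)).
    exists 0%N, 0%VS; rewrite dimv0; split=> //; first exact: submod0.
    by move/esym/zeromodP.
  by move=> _ [V [_ _ <-]]; rewrite -dimvf dimvS ?subvf.
exists V; split=> // W sW VW Wf; apply/esym/eqP; rewrite eqEdim VW dV dmax //.
by exists W.
Qed.

(** The module [Y] is the simple top of [X]. A nonzero map from Z to it lifts
    to a map onto X modulo the maximal submodule, and the projection from X
    lifts back through Z; the composite endomorphism of [X] is not in the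
    radical, since it induces the identity on the top. *)
Lemma exists_top X : indecomposable X -> projective X ->
  exists Y, hdim X Y != 0%N /\
    forall Z, indecomposable Z -> projective Z -> hdim Z Y != 0%N -> iso X Z.
Proof.
move=> Xi pX; have [V [sV Vf Vmax]] := exists_maximal_submod (proj1 Xi).
have [Y [q [qA qf qk]]] := exists_quotient sV.
have q0 : q <> 0.
  move=> q0; case: Vf; rewrite -qk; apply/vspaceP=> x.
  by rewrite memvf memv_ker q0 zero_lfunE eqxx.
exists Y; split=> [|Z Zi pZ]; first by apply/hdim0P=> h; apply: q0; apply: h.
move/hdim0P=> ZY.
have [f fA f0] : exists2 f, f \in homv Z Y & f <> 0.
  by apply: contrapT => h; apply: ZY => f fA; apply: contrapT => f0; apply: h;
    exists f.
have [|g gA gE] := proj_lift pZ qA fA; first by rewrite qf subvf.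
have gV : (V + limg g)%VS = fullv.
  apply: contrapT => h; apply: f0.
  have /Vmax/(_ (addvSl _ _)) /(_ h) E := submod_add sV (submod_img gA).
  apply/lfunP=> x; rewrite -gE comp_lfunE zero_lfunE; apply/eqP.
  rewrite -memv_ker qk -E; apply: (subvP (addvSr _ _)).
  by rewrite memv_img ?memvf.
have ff : limg f = fullv.
  rewrite -gE limg_comp -qf -gV limgD -qk.
  suff -> : (q @: lker q = 0)%VS by rewrite add0v.
  by apply/eqP; rewrite -lkerE.
have [|h hA hE] := proj_lift pX fA qA; first by rewrite ff subvf.
have [k0|k0] := indecomp_endo Xi (homv_comp hA gA).
  apply: indecomp_summand_iso => //; first by case: Xi.
  exact: summand_of_inj_endo k0.
case: q0; have uf : limg (\1 - (g \o h))%VF = fullv by apply/eqP;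
  rewrite -limg_endo.
apply/lfunP=> x; have [y ->] := limg_surj uf x.
rewrite add_lfunE opp_lfunE id_lfunE linearB /= zero_lfunE.
by rewrite -comp_lfunE comp_lfunA gE hE subrr.
Qed.

(** A form of Nakayama's lemma. Each [X i'] is the sum of the images of
    composites X i -> Y j -> X i', and as no [X i] is isomorphic to a [Y j],
    these composites lie in the radical of the category of the [X i], which is
    nilpotent; so the [X i] would be zero. Instead of powers of the radical,
    the proof uses a maximal proper Hom-stable family of subspaces [W i], into
    which all the composites map. *)
Lemma mutual_generation (I J : finType) (B : pred I) (C : pred J)
    (X : I -> rmodule A) (Y : J -> rmodule A) :
  (forall i, B i -> indecomposable (X i)) ->
  (forall j, C j -> indecomposable (Y j)) ->
  (forall i j, B i -> C j -> ~ iso (X i) (Y j)) ->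
  (forall i, B i -> trace C Y (X i) = fullv) ->
  (forall j, C j -> trace B X (Y j) = fullv) ->
  forall i, ~~ B i.
Proof.
move=> Xi Yi XY tX tY i0; apply/negP=> Bi0.
pose stable (W : forall i, {vspace X i}) := forall i i' (f : 'Hom(X i, X i')),
  B i -> B i' -> f \in homv (X i) (X i') -> (f @: W i <= W i')%VS.
pose proper (W : forall i, {vspace X i}) := exists2 i, B i & W i <> fullv.
pose Q m := exists W, [/\ stable W, proper W & (\sum_i \dim (W i) = m)%N].
have [m [W [sW pW mW]] mmax] : exists2 m, Q m & forall m', Q m' -> (m' <= m)%N.
  apply: (@max_dim_exists _ (\sum_i dim (X i))%N).
    exists (\sum_i \dim (0%VS : {vspace X i}))%N, (fun i => 0%VS); split=> //.
      by move=> i i' f _ _ _; rewrite limg0 subvv.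
    exists i0 => //; case: (Xi _ Bi0) => X0 _ /esym X0'; apply: X0.
    exact/zeromodP.
  move=> _ [W [_ _ <-]]; apply: leq_sum => i _.
  by rewrite -dimvf dimvS ?subvf.
(* Every composite through the other family has its values in [W]. *)
have key i i' j (a : 'Hom(X i, Y j)) (b : 'Hom(Y j, X i')) :
    B i -> B i' -> C j ->
    a \in homv (X i) (Y j) -> b \in homv (Y j) (X i') ->
    forall x, b (a x) \in W i'.
  move=> Bi Bi' Cj aA bA x; apply/negPn/negP=> yW; set y := b (a x) in yW.
  (* Adding the translates of a missing value [y] keeps the family stable, so by
     maximality fills everything; in particular it reaches [x] itself. *)
  pose ev l : 'Hom('Hom(X i', X l), X l) :=
    linfun (fun f : 'Hom(X i', X l) => f y).
  have evE l f : ev l f = f y.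
    by apply: linfun_linearE => k u v; rewrite add_lfunE scale_lfunE.
  pose W' l := (W l + (ev l @: homv (X i') (X l)))%VS.
  have sW' : stable W'.
    move=> l l' f Bl Bl' fA; rewrite /W' limgD subv_add.
    rewrite (subv_trans (sW _ _ _ Bl Bl' fA)) ?addvSl //=.
    apply: subv_trans (addvSr _ _);
      apply/subvP=> _ /memv_imgP[_ /memv_imgP[g gA ->] ->].
    by rewrite evE -comp_lfunE -evE memv_img // homv_comp.
  have W'f l : B l -> W' l = fullv.
    move=> Bl; apply: contrapT => h; have : Q (\sum_l \dim (W' l))%N.
      by exists W'; split=> //; exists l.
    move/mmax; rewrite -mW; apply/negP; rewrite -ltnNge.
    rewrite (bigD1 i') //= [X in (_ < X)%N](bigD1 i') //= -addSn.
    apply: leq_add; last by apply: leq_sum => k _; rewrite dimvS ?addvSl.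
    rewrite ltnNge; apply: contra yW => le.
    have -> : W i' = W' i' by apply/eqP; rewrite eqEdim addvSl le.
    apply: (subvP (addvSr _ _));
      have -> : y = ev i' \1%VF by rewrite evE id_lfunE.
    by rewrite memv_img ?homv_id.
  have xW : x \in W i.
    have : x \in W' i by rewrite W'f ?memvf.
    case/memv_addP=> w wW [_ /memv_imgP[g gA ->]]; rewrite evE => xE.
    (* [x - g (b (a x))] lies in [W i], and [1 - g b a] is invertible *)
    have k0 : lker (\1 - ((g \o b) \o a))%VF == 0%VS.
      by apply: one_sub_factor_inj => //;
        [exact: Xi|exact: Yi|exact: XY|exact: homv_comp].
    set u := (\1 - _)%VF in k0; have uA : u \in homv (X i) (X i).
      by rewrite memvB ?homv_id // homv_comp // homv_comp.
    have uV := homv_inv uA k0 (eqP (etrans (esym (limg_endo _)) k0)).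
    have ux : u x = w.
      rewrite add_lfunE opp_lfunE id_lfunE !comp_lfunE -/y {1}xE.
      by rewrite addrK.
    rewrite -[x](lker0_lfunK k0) ux.
    by apply: (subvP (sW _ _ _ Bi Bi uV)); rewrite memv_img.
  case/negP: yW; rewrite /y -comp_lfunE.
  by apply: (subvP (sW _ _ _ Bi Bi' (homv_comp aA bA))); rewrite memv_img.
case: pW => i Bi; apply; apply/eqP; rewrite eqEsubv subvf -(tX _ Bi).
apply: trace_sub => j b Cj bA; apply/subvP=> _ /memv_imgP[y _ ->].
rewrite memv_preim; move: y (memvf y); apply/subvP; rewrite -(tY _ Cj).
apply: trace_sub => l a Bl aA; apply/subvP=> _ /memv_imgP[x _ ->].
by rewrite -memv_preim; apply: key aA bA _.
Qed.
End Tops.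

(** * The pairing of g-vectors with modules *)

Section GValue.
Variables (R : realType) (K : fieldType) (A : falgType K) (n : nat).
Variable P : 'I_n -> rmodule A.
Implicit Types M N L X Y Z : rmodule A.

(** The value of a g-vector on modules, as in [gval_row]: the vectors of R^n
    become functionals on dimension data of modules. By [gval_inj] nothing is
    lost. *)
Definition gval (v : 'rV[R]_n) Y : R := \sum_l v 0 l * (hdim (P l) Y)%:R.
Notation gR g := (map_mx intr g : 'rV[R]_n).

Lemma gval_sum (I : finType) (c : I -> R) (v : I -> 'rV[R]_n) Y :
  gval (\sum_i c i *: v i) Y = \sum_i c i * gval (v i) Y.
Proof.
rewrite /gval; under eq_bigr do rewrite summxE mulr_suml.
rewrite exchange_big /=; apply: eq_bigr => i _; rewrite mulr_sumr.
by apply: eq_bigr => l _; rewrite mxE mulrA.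
Qed.

Lemma gval_opp v Y : gval (- v) Y = - gval v Y.
Proof. by rewrite /gval -sumrN; apply: eq_bigr => l _; rewrite mxE mulNr. Qed.

Lemma gval_row a b Y :
  gval (gR (\row_i ((a i)%:Z - (b i)%:Z))) Y =
  (hdim (proj_sum P a) Y)%:R - (hdim (proj_sum P b) Y)%:R.
Proof.
rewrite /gval !hdim_proj_sum !natr_sum -sumrB; apply: eq_bigr => l _.
by rewrite !mxE rmorphB /= !natrM mulrBl.
Qed.

(** The defect is the dimension of the cokernel of Hom(P0, Y) -> Hom(P1, Y),
    which is dual to Hom(Y, tau X). *)
Lemma gval_le X g Y : is_gvector P X g -> gval (gR g) Y <= (hdim X Y)%:R.
Proof.
case=> a [b [d [e [[_ [dA eA] [ef de] _] ->]]]]; rewrite gval_row.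
by rewrite lerBlDr -natrD ler_nat (hdim_pres_le dA eA ef de).
Qed.

Lemma gval_eq X g Y : is_gvector P X g ->
  (forall (P1 P0 : rmodule A) (d : 'Hom(P1, P0)) (e : 'Hom(P0, X)),
     min_proj_pres d e -> factors d Y) ->
  gval (gR g) Y = (hdim X Y)%:R.
Proof.
case=> a [b [d [e [pd ->]]]] fd; rewrite gval_row.
have [_ [dA eA] [ef de] _] := pd.
by rewrite (hdim_pres_eq dA eA ef de (fd _ _ _ _ pd)) natrD addrK.
Qed.

(** A projective is its own projective cover, so its minimal presentation has
    zero in degree one. *)
Lemma projective_pres0 X (P1 P0 : rmodule A)
    (d : 'Hom(P1, P0)) (e : 'Hom(P0, X)) :
  projective X -> min_proj_pres d e -> zeromod P1.
Proof.
move=> pX [_ [dA eA] [ef de] [sE sD]].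
have [|s sA sE'] := proj_lift pX eA (homv_id X); first by rewrite ef subvf.
have se : limg (s \o e)%VF = fullv.
  apply: (superfluous_epi eA sE (homv_comp eA sA)).
  by rewrite comp_lfunA sE' comp_lfun1l.
have e0 : lker e = 0%VS.
  apply/eqP; rewrite -subv0;
    have : lker (s \o e)%VF == 0%VS by rewrite limg_endo se.
  move/eqP<-; apply/subvP=> x; rewrite !memv_ker comp_lfunE => /eqP->.
  by rewrite linear0.
apply/zeromodP/esym; apply: sD; first exact: submod0.
rewrite addv0; apply/vspaceP=> x; rewrite memvf memv_ker -memv0 -e0 -de.
by rewrite memv_img ?memvf.
Qed.

Lemma gval_projective X g Y : projective X -> is_gvector P X g ->
  gval (gR g) Y = (hdim X Y)%:R.
Proof.
move=> pX /gval_eq; apply=> P1 P0 d e /(projective_pres0 pX) z f _.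
exists 0; first exact: mem0v.
by apply/lfunP=> x; rewrite (z x) !linear0.
Qed.

Lemma summand_projective X M : projective M -> summand X M -> projective X.
Proof.
move=> pM /summand_retract[i [p [iA pA pi]]] Y Z g f gA gf fA.
have [h hA hE] := pM _ _ _ _ gA gf (homv_comp pA fA).
exists (h \o i)%VF; first exact: homv_comp hA.
by rewrite comp_lfunA hE -comp_lfunA pi comp_lfun1r.
Qed.

Hypothesis Pi : forall i, indecomposable (P i) /\ projective (P i).
Hypothesis Pinj : forall i j, iso (P i) (P j) -> i = j.

(** The tops of the [P l] are dual to the coordinates up to nonzero factors. *)
Lemma gval_inj v w : (forall Y, gval v Y = gval w Y) -> v = w.
Proof.
move=> vw; apply/rowP=> l; have [Pil Ppl] := Pi l.
have [Y [Y0 Yu]] := exists_top Pil Ppl.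
have E u : gval u Y = u 0 l * (hdim (P l) Y)%:R.
  rewrite /gval (bigD1 l) //= big1 ?addr0 // => m ml.
  have [->|h0] := eqVneq (hdim (P m) Y) 0%N; first by rewrite mulr0.
  have [Pim Ppm] := Pi m.
  by case/eqP: ml; apply: Pinj; apply: iso_sym; apply: Yu.
have := vw Y; rewrite !E; apply: mulIf.
by rewrite pnatr_eq0.
Qed.

(** The vector in [is_gvector] depends only on the isomorphism class, although
    it is read off from a chosen presentation: isomorphic modules give the
    same functional. *)
Lemma gvector_iso X X' g g' :
  iso X X' -> is_gvector P X g -> is_gvector P X' g' ->
  gR g = gR g'.
Proof.
move=> XX' [a [b [d [e [pd ->]]]]] [a' [b' [d' [e' [pd' ->]]]]].
apply: gval_inj => Y; rewrite !gval_row.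
by have [-> ->] := hdim_pres_iso Y pd pd' (iso_sym XX').
Qed.

(** [tg i] tells whether [X i] is taken from the projective part of the pair,
    whose rays carry a minus sign. *)
Definition gen_family (T : rpair A) k (X : 'I_k -> rmodule A)
    (tg : 'I_k -> bool) (v : 'I_k -> 'rV[R]_n) := forall i, [/\ indecomposable (X i),
   summand (X i) (if tg i then T.2 else T.1)
 & exists2 g, is_gvector P (X i) g & v i = if tg i then - gR g else gR g].

Section Torsion.
Variables (T : rpair A) (k : nat) (X : 'I_k -> rmodule A) (tg : 'I_k -> bool).
Variables (v : 'I_k -> 'rV[R]_n) (c : 'I_k -> R).
Hypothesis Tr : tau_rigid_pair T.
Hypothesis fam : gen_family T X tg v.
Hypothesis c0 : forall i, 0 <= c i.

(** The modules with nonzero coefficient, leaving out the projective part: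
    they generate the torsion class that belongs to the point
    [\sum_i c i *: v i]. *)
Definition mod_support i := ~~ tg i && (c i != 0).
Notation B := mod_support.
Notation theta := (\sum_i c i *: v i).

Lemma tau_rigid_factors i j (P1 P0 : rmodule A)
    (d : 'Hom(P1, P0)) (e : 'Hom(P0, X i)) :
  ~~ tg i -> ~~ tg j -> min_proj_pres d e -> factors d (X j).
Proof.
move=> /negbTE ti /negbTE tj pd.
have [[tM tMt /(factors_of_tau tMt)[Q1 [Q0 [d0 [e0 [pd0 fd0]]]]]] _ _] := Tr.
have [_ si _] := fam i; have [_ sj _] := fam j; rewrite ti in si;
  rewrite tj in sj.
exact: factors_summand sj (factors_retract pd0 pd si fd0).
Qed.

(** The vanishing Ext^1(M, Fac M) = 0 in terms of presentations, relative to a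
    submodule: a map [P1 -> Y] into the trace splits by projectivity into maps
    through the [X j], and each of them extends along [d] by tau-rigidity. The
    extension again has values in the trace. *)
Lemma factors_in_trace i Y (P1 P0 : rmodule A)
    (d : 'Hom(P1, P0)) (e : 'Hom(P0, X i)) :
  ~~ tg i -> min_proj_pres d e ->
  forall f, f \in homv P1 Y -> (limg f <= trace B X Y)%VS ->
  exists h, [/\ h \in homv P0 Y, (limg h <= trace B X Y)%VS & f = (h \o d)%VF].
Proof.
move=> ti pd; have [[pP1 _] _ _ _] := pd; apply: proj_trace_ind => //.
- exists 0; rewrite mem0v comp_lfun0l; split=> //.
  by rewrite lim0g sub0v.
- move=> f g [h [hA hs ->]] [h' [h'A h's ->]]; exists (h + h').
  rewrite memvD // comp_lfunDl; split=> //; apply/subvP=> _ /memv_imgP[x _ ->].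
  rewrite add_lfunE memvD //; [apply: (subvP hs)|apply: (subvP h's)];
    by rewrite memv_img ?memvf.
move=> j h g /[dup] Bj /andP[tj _] hA gA.
have [h' h'A ->] := tau_rigid_factors ti tj pd hA.
exists (g \o h')%VF; rewrite comp_lfunA homv_comp //; split=> //.
rewrite limg_comp; apply: subv_trans (limg_trace Bj gA).
by rewrite limgS ?subvf.
Qed.

(** Hom(Q, M) = 0 extends to all quotients of sums of summands of [M], as [Q]
    is projective. *)
Lemma hom_proj_part i Y : tg i -> trace B X Y = fullv -> hdim (X i) Y = 0%N.
Proof.
move=> ti tY; have [_ pQ Q0] := Tr; have [_ si _] := fam i; rewrite ti in si.
apply/eqP/hdim0P=> f fA; move: f fA (subvf (limg f)); rewrite -tY => f fA.
apply: (@proj_trace_ind _ _ _ _ _ _ (X i) (fun f => f = 0)) => //.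
- exact: summand_projective si.
- by move=> u w -> ->; rewrite addr0.
move=> j h g /andP[/negbTE tj _] hA gA; have [_ sj _] := fam j;
  rewrite tj in sj.
have [i1 [p1 [i1A p1A pi1]]] := summand_retract si.
have [i2 [p2 [i2A p2A pi2]]] := summand_retract sj.
have : (i2 \o (h \o p1))%VF \in homv T.2 T.1 by rewrite homv_comp // homv_comp.
rewrite Q0 memv0 => /eqP z.
suff -> : h = 0 by rewrite comp_lfun0r.
rewrite -[h]comp_lfun1r -pi1 -[h]comp_lfun1l -pi2.
by rewrite -!comp_lfunA (comp_lfunA h) (comp_lfunA i2) z comp_lfun0l
  comp_lfun0r.
Qed.

(** On Fac of the support the correction terms dim Hom(-, tau X) and dim
    Hom(Q, -) vanish, so what remains is a nonnegative combination of dim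
    Hom(X i, Y), not all zero. *)
Lemma gval_trace_pos Y : ~ zeromod Y -> trace B X Y = fullv -> 0 < gval theta Y.
Proof.
move=> Y0 tY; have vE i : gval (v i) Y = if tg i then 0 else (hdim (X i) Y)%:R.
  have [_ si [g gv ->]] := fam i; case: ifP => ti; rewrite ti in si.
    have [_ pQ _] := Tr; rewrite gval_opp (gval_projective _
      (summand_projective pQ si) gv).
    by rewrite hom_proj_part // oppr0.
  apply: gval_eq => // P1 P0 d e pd f fA.
  have [|h [hA _ ->]] := factors_in_trace (negbT ti) pd fA;
    first by rewrite tY subvf.
  by exists h.
have ge0 i : 0 <= c i * gval (v i) Y.
  by rewrite mulr_ge0 // vE; case: ifP.
rewrite gval_sum lt_neqAle sumr_ge0 // andbT eq_sym; apply/negP=> /eqP.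
move/psumr_eq0P => /(_ (fun i _ => ge0 i)) z; apply: Y0; apply/zeromodP.
rewrite -tY; apply/eqP; rewrite -subv0;
  apply: trace_sub => i f /andP[/negbTE ti ci] fA.
have /eqP := z i isT; rewrite mulf_eq0 (negbTE ci) vE ti pnatr_eq0.
by move/hdim0P/(_ _ fA)->; rewrite lim0g subvv.
Qed.

(** Conversely, positivity on all quotients forces membership in Fac. The
    quotient [Z] of [Y] by its trace admits no map from the [X i] in the
    support, because such a map would lift to [Y] by [factors_in_trace], and
    lifts land in the trace. Hence the value of the point at [Z] is at most 0,
    and [Z] is zero. *)
Lemma trace_full Y :
  (forall Z (q : 'Hom(Y, Z)), q \in homv Y Z -> limg q = fullv -> ~ zeromod Z ->
     0 < gval theta Z) -> trace B X Y = fullv.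
Proof.
move=> pos; have [Z [q [qA qf qk]]] := exists_quotient (submod_trace B X Y).
have [Z0|Z0] := pselect (zeromod Z).
  apply/vspaceP=> y; rewrite memvf -qk memv_ker; apply/eqP; exact: Z0.
have hom0 i : B i -> hdim (X i) Z = 0%N.
  move=> Bi; have /andP[ti _] := Bi;
    have [_ _ [g [a [b [d [e [pd _]]]]] _]] := fam i.
  apply/eqP/hdim0P=> f fA.
  have [[_ pP0] [dA eA] [ef de] _] := pd.
  have [|h hA hE] := proj_lift pP0 qA (homv_comp eA fA);
    first by rewrite qf subvf.
  (* correct the lift [h] on [P0] by a map [k'] into the trace, so that it
     descends to a map [l] from [X i] to [Y] *)
  have [|k' [k'A k's k'E]] := factors_in_trace ti pd (homv_comp dA hA).
    rewrite -qk; apply/subvP=> _ /memv_imgP[x _ ->]; rewrite memv_ker.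
    rewrite comp_lfunE -(comp_lfunE q) hE comp_lfunE.
    have : d x \in lker e by rewrite -de memv_img ?memvf.
    by rewrite memv_ker => /eqP->; rewrite linear0.
  have hkA : h - k' \in homv _ Y by rewrite memvB.
  have [|l lA lE] := hom_factor_epi eA ef hkA.
    rewrite -de; apply/subvP=> _ /memv_imgP[x _ ->]; rewrite memv_ker.
    by rewrite add_lfunE opp_lfunE -!comp_lfunE k'E subrr.
  apply/lfunP=> y; have [x ->] := limg_surj ef y; rewrite zero_lfunE.
  rewrite -comp_lfunE -hE comp_lfunE.
  have -> : h x = l (e x) + k' x.
    by rewrite -comp_lfunE lE add_lfunE opp_lfunE subrK.
  apply/eqP; rewrite -memv_ker qk memvD //.
    by apply: (subvP (limg_trace Bi lA)); rewrite memv_img ?memvf.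
  by apply: (subvP k's); rewrite memv_img ?memvf.
have := pos _ _ qA qf Z0; rewrite gval_sum ltNge; case/negP.
rewrite -oppr_ge0 -sumrN sumr_ge0 // => i _; rewrite oppr_ge0.
have [ci|ci] := eqVneq (c i) 0; first by rewrite ci mul0r.
rewrite mulr_ge0_le0 //; have [_ si [g gv ->]] := fam i.
case: ifP => ti; rewrite ti in si.
  have [_ pQ _] := Tr; rewrite gval_opp (gval_projective _ (summand_projective
    pQ si) gv).
  by rewrite oppr_le0.
by apply: le_trans (gval_le _ gv) _; rewrite hom0 // /mod_support ti.
Qed.
End Torsion.
End GValue.

(** * Cones *)

Section Cones.
Variables (R : realType) (n : nat).
Implicit Types G : set 'rV[R]_n.

Lemma cone_sub G G' : (G `<=` G')%classic -> (cone G `<=` cone G')%classic.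
Proof. by move=> s x [k [v [c [vG c0 xE]]]]; exists k, v, c; split=> // i;
  apply/s/vG. Qed.

Lemma cone0 G : cone G 0.
Proof.
exists 0%N, (fun _ => 0), (fun _ => 0); split=> //; first by case.
by rewrite big_ord0.
Qed.

Lemma cone_add G a w x : G w -> 0 <= a -> cone G x -> cone G (a *: w + x).
Proof.
move=> Gw a0 [k [v [c [vG c0 ->]]]].
exists k.+1, (fun i => if unlift ord0 i is Some j then v j else w),
  (fun i => if unlift ord0 i is Some j then c j else a).
split=> [i|i|]; [by case: unliftP..|].
rewrite big_ord_recl unlift_none; congr (_ + _).
by apply: eq_bigr => i _; rewrite liftK.
Qed.
End Cones.

Section Common.
Variables (K : fieldType) (A : falgType K).
Implicit Types M N L X Y Z U Q : rmodule A.

Lemma summand_dsum_add N N1 X : summand X N1 -> summand (dsum N X) (dsum N N1).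
Proof.
move=> /summand_retract[i [p [iA pA pi]]].
have lin Z Z' (f : 'Hom(Z, Z')) : f \in homv Z Z' ->
    ((dinl \o dfst) + (dinr \o (f \o dsnd)))%VF \in homv (dsum N Z) (dsum N Z').
  move=> fA; rewrite memvD //;
    first exact: homv_comp (dfst_homv _ _) (dinl_homv _ _).
  exact: homv_comp (homv_comp (dsnd_homv _ _) fA) (dinr_homv _ _).
apply: (retract_summand (lin _ _ _ iA) (lin _ _ _ pA)).
apply/lfunP=> -[x y]; rewrite comp_lfunE !add_lfunE !comp_lfunE.
rewrite !(dinlE, dinrE, dfstE, dsndE) id_lfunE /= !add0r !addr0.
by rewrite -(comp_lfunE p) pi id_lfunE; congr pair; rewrite ?addr0 ?add0r.
Qed.

(** An indecomposable common summand that is missing from [N] lies in both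
    complements of [N], so it can be added to [N]. *)
Lemma common_summand_extend N M M' X : indecomposable X ->
  summand N M -> summand N M' -> summand X M -> summand X M' ->
  summand X N \/ (summand (dsum N X) M /\ summand (dsum N X) M').
Proof.
move=> Xi [N1 MN] [N1' MN'] XM XM'.
have ext L L1 : iso L (dsum N L1) -> summand X L ->
    summand X N \/ summand (dsum N X) L.
  move=> LN XL; have := summand_trans XL (iso_summand LN).
  case/(summand_dsum Xi); [by left|right].
  exact: summand_trans (summand_dsum_add N b) (iso_summand (iso_sym LN)).
case: (ext _ _ MN XM); [by left|move=> a].
by case: (ext _ _ MN' XM'); [left|right].
Qed.

Lemma dim_dsum_neq N X : indecomposable X -> ~ iso N (dsum N X).
Proof.
move=> [X0 _] /dim_iso; have -> : dim (dsum N X) = (dim N + dim X)%N by [].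
move/eqP; rewrite -{1}[dim N]addn0 eqn_add2l eq_sym => /eqP dX.
by apply: X0; apply/zeromodP/eqP; rewrite -dimv_eq0 dimvf dX.
Qed.

(** Otherwise [X] could be added to [S] by [common_summand_extend], and
    comparing dimensions shows that the enlarged pair is not isomorphic to
    [S]. *)
Lemma max_common_indecomp T T' S X :
  max_common_summand T T' S -> indecomposable X ->
  (summand X T.1 -> summand X T'.1 -> summand X S.1) /\
  (summand X T.2 -> summand X T'.2 -> summand X S.2).
Proof.
case: T T' S => [M Q] [M' Q'] [N U] [[/= NM UQ] [/= NM' UQ'] mx] Xi.
have refl Z : summand Z Z.
  by apply: (retract_summand (homv_id Z) (homv_id Z)); rewrite comp_lfun1l.
have inl Z : summand Z (dsum Z X).
  exact: retract_summand (dinl_homv _ _) (dfst_homv _ _) (dfst_inl _ _).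
split=> a b.
  have [//|[c d]] := common_summand_extend Xi NM NM' a b.
  by have [/= /(dim_dsum_neq Xi)] := mx (dsum N X, U) (conj c UQ) (conj d UQ')
    (conj (inl N) (refl U)).
have [//|[c d]] := common_summand_extend Xi UQ UQ' a b.
by have [/= _ /(dim_dsum_neq Xi)] := mx (N, dsum U X) (conj NM c) (conj NM' d)
  (conj (refl N) (inl U)).
Qed.
End Common.

Section Cancellation.
Variables (R : realType) (K : fieldType) (A : falgType K) (n : nat).
Variable P : 'I_n -> rmodule A.
Hypothesis Pi : forall i, indecomposable (P i) /\ projective (P i).
Hypothesis Pinj : forall i j, iso (P i) (P j) -> i = j.
Implicit Types T : rpair A.

(** By [gval_trace_pos] and [trace_full] the torsion class Fac of the support
    is determined by the point, whatever the expression of that point; so both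
    supports generate each other, and [mutual_generation] applies. *)
Lemma mod_support_empty T T' k k' (X : 'I_k -> rmodule A)
    (X' : 'I_k' -> rmodule A)
    tg tg' (v : 'I_k -> 'rV[R]_n) v' c c' :
  tau_rigid_pair T -> tau_rigid_pair T' ->
  gen_family P T X tg v -> gen_family P T' X' tg' v' ->
  (forall i, 0 <= c i) -> (forall j, 0 <= c' j) ->
  \sum_i c i *: v i = \sum_j c' j *: v' j ->
  (forall i j, c i != 0 -> c' j != 0 -> tg i = tg' j -> ~ iso (X i) (X' j)) ->
  forall i, ~~ mod_support tg c i.
Proof.
move=> Tr Tr' fam fam' c0 c0' E dj.
apply: (@mutual_generation _ _ _ _ _ (mod_support tg' c') X X').
- by move=> i _; have [] := fam i.
- by move=> i _; have [] := fam' i.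
- move=> i j /andP[/negbTE ti ci] /andP[/negbTE tj cj].
  by apply: dj => //; rewrite ti tj.
- move=> i Bi; apply: (trace_full Tr' fam' c0') => Z q qA qf Z0; rewrite -E.
  by apply: (gval_trace_pos Tr fam c0) => //;
    apply: trace_quotient qA qf (trace_self _ Bi).
move=> i Bi; apply: (trace_full Tr fam c0) => Z q qA qf Z0; rewrite E.
by apply: (gval_trace_pos Tr' fam' c0') => //;
  apply: trace_quotient qA qf (trace_self _ Bi).
Qed.

(** By [mod_support_empty] only the projective parts are left. Both sides are
    combinations of -g^P for projectives; the top of an indecomposable
    projective on the left is not seen by the right hand side. *)
Lemma disjoint_support_zero T T' k k' (X : 'I_k -> rmodule A)
    (X' : 'I_k' -> rmodule A)
    tg tg' (v : 'I_k -> 'rV[R]_n) v' c c' :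
  tau_rigid_pair T -> tau_rigid_pair T' ->
  gen_family P T X tg v -> gen_family P T' X' tg' v' ->
  (forall i, 0 <= c i) -> (forall j, 0 <= c' j) ->
  \sum_i c i *: v i = \sum_j c' j *: v' j ->
  (forall i j, c i != 0 -> c' j != 0 -> tg i = tg' j -> ~ iso (X i) (X' j)) ->
  forall i, c i = 0.
Proof.
move=> Tr Tr' fam fam' c0 c0' E dj.
have B0 := mod_support_empty Tr Tr' fam fam' c0 c0' E dj.
have B0' : forall j, ~~ mod_support tg' c' j.
  apply: (mod_support_empty Tr' Tr fam' fam c0' c0 (esym E)).
  by move=> j i cj ci t /iso_sym; apply: dj.
have part2 T1 k1 (X1 : 'I_k1 -> rmodule A) tg1 (v1 : 'I_k1 -> 'rV[R]_n)
    (c1 : 'I_k1 -> R) :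
  tau_rigid_pair T1 -> gen_family P T1 X1 tg1 v1 ->
  (forall j, ~~ mod_support tg1 c1 j) -> forall j, c1 j != 0 ->
  [/\ tg1 j, projective (X1 j) & forall Y,
    gval P (v1 j) Y = - (hdim (X1 j) Y)%:R].
  move=> [_ pQ _] fam1 B1 j cj;
    have := B1 j; rewrite /mod_support cj andbT negbK => tj.
  have [_ sj [g gv ->]] := fam1 j; rewrite tj in sj *.
  have pX := summand_projective pQ sj.
  by split=> // Y; rewrite gval_opp (gval_projective R _ pX gv).
move=> i; apply/eqP/negPn/negP=> ci.
have [ti pX _] := part2 _ _ _ _ _ _ Tr fam B0 i ci.
have [Xi _ _] := fam i; have [Y [hY Yu]] := exists_top Xi pX.
suff : gval P (\sum_i c i *: v i) Y < gval P (\sum_j c' j *: v' j) Y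
  by rewrite E ltxx.
rewrite !gval_sum [X in _ < X]big1 => [|j _]; last first.
  have [->|cj] := eqVneq (c' j) 0; first by rewrite mul0r.
  have [tj pX' ->] := part2 _ _ _ _ _ _ Tr' fam' B0' j cj.
  have [->|h0] := eqVneq (hdim (X' j) Y) 0%N; first by rewrite oppr0 mulr0.
  have [X'i _ _] := fam' j.
  by case: (dj i j ci cj); [rewrite ti tj|exact: Yu].
have le0 m : c m * gval P (v m) Y <= 0.
  have [->|cm] := eqVneq (c m) 0; first by rewrite mul0r.
  have [_ _ ->] := part2 _ _ _ _ _ _ Tr fam B0 m cm.
  by rewrite mulrN oppr_le0 mulr_ge0.
rewrite (bigD1 i) //= -oppr_gt0 opprD ltr_pwDl //; last first.
  by rewrite -sumrN sumr_ge0 // => m _; rewrite oppr_ge0.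
have [_ _ ->] := part2 _ _ _ _ _ _ Tr fam B0 i ci.
by rewrite mulrN opprK mulr_gt0 // ?lt0r ?ci ?c0 // pnatr_eq0 hY ler0n.
Qed.

Definition lower k (c : 'I_k -> R) i (m : R) l :=
  if l == i then c l - m else c l.

Lemma sum_update k (v : 'I_k -> 'rV[R]_n) (c : 'I_k -> R) i m :
  \sum_l c l *: v l =
  m *: v i + \sum_l lower c i m l *: v l.
Proof.
rewrite /lower (bigD1 i) //= [X in _ = _ + X](bigD1 i) //= eqxx addrA scalerBl
  addrCA subrr addr0.
by congr (_ + _); apply: eq_bigr => l /negbTE->.
Qed.

Definition supp k (c : 'I_k -> R) := #|[pred i | c i != 0]|.

Lemma supp_le k (c : 'I_k -> R) i (m : R) : c i != 0 ->
  (supp (lower c i m) <= supp c)%N.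
Proof.
move=> ci; apply: subset_leq_card; apply/fintype.subsetP=> l;
  rewrite !inE /lower.
by case: (l =P i) => [->|_].
Qed.

Lemma supp_lt k (c : 'I_k -> R) i : c i != 0 ->
  (supp (lower c i (c i)) < supp c)%N.
Proof.
move=> ci; apply: proper_card; apply/fintype.properP; split.
  by apply/fintype.subsetP=> l; rewrite !inE /lower;
    case: (l =P i) => [->|_] //; rewrite subrr eqxx.
by exists i; rewrite !inE // /lower eqxx subrr eqxx.
Qed.

(** Induction on the number of nonzero coefficients. As long as the two
    expressions use a common isomorphism class, the smaller of its two
    coefficients is subtracted from both, which makes one of them zero and
    splits off a multiple of a vector of [G]; afterwards
    [disjoint_support_zero] applies. *)
Lemma common_cone (G : set 'rV[R]_n) T T' k k' (X : 'I_k -> rmodule A)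
    (X' : 'I_k' -> rmodule A) tg tg' (v : 'I_k -> 'rV[R]_n) v' :
  tau_rigid_pair T -> tau_rigid_pair T' ->
  gen_family P T X tg v -> gen_family P T' X' tg' v' ->
  (forall i j, tg i = tg' j -> iso (X i) (X' j) -> G (v i)) ->
  forall c c', (forall i, 0 <= c i) -> (forall j, 0 <= c' j) ->
  \sum_i c i *: v i = \sum_j c' j *: v' j -> cone G (\sum_i c i *: v i).
Proof.
move=> Tr Tr' fam fam' com.
have veq i j : tg i = tg' j -> iso (X i) (X' j) -> v i = v' j.
  move=> t XX; have [_ _ [g gv ->]] := fam i; have [_ _ [g' gv' ->]] := fam' j.
  by rewrite t (gvector_iso R Pi Pinj XX gv gv').
move=> c c'; have [N le] := ubnP (supp c + supp c')%N.
elim: N c c' le => // N IH c c' le c0 c0' E.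
have [[i [j [ci cj t XX]]]|none] := pselect (exists i j,
    [/\ c i != 0, c' j != 0, tg i = tg' j & iso (X i) (X' j)]); last first.
  rewrite big1 => [|i _]; first exact: cone0.
  rewrite (disjoint_support_zero Tr Tr' fam fam' c0 c0' E) ?scale0r //.
  by move=> l j cl cj t XX; apply: none; exists l, j.
pose m := Num.min (c i) (c' j).
have m0 : 0 <= m by rewrite le_min c0 c0'.
rewrite (sum_update v c i m); apply: (cone_add (com _ _ t XX) m0).
apply: (IH _ (lower c' j m)).
- rewrite /m; case: leP => _;
  apply: leq_trans (_ : supp c + supp c' <= N)%N => //.
    by rewrite -addSn leq_add ?supp_lt ?supp_le.
  by rewrite -addnS leq_add ?supp_lt ?supp_le.
- by move=> l; rewrite /lower; case: (l =P i) => [->|_] //;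
  rewrite subr_ge0 ge_min lexx.
- by move=> l; rewrite /lower; case: (l =P j) => [->|_] //;
  rewrite subr_ge0 ge_min lexx orbT.
by move: E; rewrite (sum_update v c i m) (sum_update v' c' j m) (veq _ _ t XX)
  => /addrI.
Qed.

Lemma gen_familyP T k (v : 'I_k -> 'rV[R]_n) :
  (forall i, gcone_generators P T (v i)) -> exists X tg, gen_family P T X tg v.
Proof.
move=> vG.
have /choice[f fE] : forall i, exists Xt : rmodule A * bool,
    [/\ indecomposable Xt.1, summand Xt.1 (if Xt.2 then T.2 else T.1)
   & exists2 g, is_gvector P Xt.1 g &
     v i = if Xt.2 then - map_mx intr g else map_mx intr g].
  move=> i; case: (vG i) => -[X [g [Xi XT gv vE]]].
    by exists (X, false); split=> //; exists g.
  by exists (X, true); split=> //; exists g.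
by exists (fun i => (f i).1), (fun i => (f i).2).
Qed.

Lemma gcone_generators_summand T S : pair_summand S T ->
  (gcone_generators P (R := R) S `<=` gcone_generators P T)%classic.
Proof.
case=> s1 s2 x [] [X [g [Xi XS gv xE]]]; [left|right]; exists X, g; split=> //.
  exact: summand_trans s1.
exact: summand_trans s2.
Qed.
End Cancellation.

Theorem theorem6p13 (R : realType) (K : fieldType) (A : falgType K) (n : nat)
    (S P : 'I_n -> rmodule A) (M Q M' Q' N U : rmodule A) :
  basic A ->
  iso_representatives (@simple_module K A) S ->
  iso_representatives (fun X => indecomposable X /\ projective X) P ->
  tau_rigid_pair (M, Q) -> tau_rigid_pair (M', Q') ->
  max_common_summand (M, Q) (M', Q') (N, U) ->
  (gcone P R (M, Q) `&` gcone P R (M', Q') = gcone P R (N, U))%classic.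
Proof.
move=> _ _ [Pi Pinj _] Tr Tr' mx; have [sT sT' _] := mx.
apply/seteqP; split=> x; last first.
  by move=> xS; split; apply: cone_sub xS; apply: gcone_generators_summand.
case=> -[k [v [c [vG c0 ->]]]] [k' [v' [c' [vG' c0' E]]]].
have [X [tg fam]] := gen_familyP vG; have [X' [tg' fam']] := gen_familyP vG'.
apply: (common_cone Pi Pinj Tr Tr' fam fam' _ c0 c0' E) => i j t XX.
have [Xi si [g gv vE]] := fam i; have [_ sj _] := fam' j.
have [m1 m2] := max_common_indecomp mx Xi.
have {}sj := summand_trans (iso_summand XX) sj.
rewrite -t in sj; case: (tg i) si sj vE => si sj vE.
  by right; exists (X i), g; split=> //; apply: m2.
by left; exists (X i), g; split=> //; apply: m1.
Qed.
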